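(* Let $m\ge2$ and let $\Omega\subset\mathbb{R}^m$ be a body with a piecewise $C^1$ boundary. Suppose $x\in\operatorname{int}\Omega$ and $\Omega$ is star-shaped at $x$. Let $\rho_{\Omega_{-x}}$ be the radial function of $\Omega_{-x}=\{y-x\mid y\in\Omega\}$. Then $$V^{(\alpha)}_\Omega(x) =\frac1\alpha\int_{S^{m-1}}\left(\rho_{\Omega_{-x}}(v)\right)^\alpha\,d\sigma(v)\qquad(\alpha\in\mathbb{R},\ \alpha\ne0),$$ $$V^{(0)}_\Omega(x) =\int_{S^{m-1}}\log\left(\rho_{\Omega_{-x}}(v)\right)\,d\sigma(v)\qquad(\alpha=0).$$
   Context: A body is a compact subset of $\mathbb{R}^m$ that is the closure of its interior. A set $\Omega$ is star-shaped at $x$ if for every $p\in\Omega\setminus\{x\}$ the segment joining $x$ and $p$ is contained in $\Omega$. The radial function of a set $M$ star-shaped at $0$ is $\rho_M:S^{m-1}\to\mathbb{R}_{\ge0}$, $\rho_M(v)=\sup\{a\ge0\mid av\in M\}$. $\mu$ is Lebesgue measure on $\mathbb{R}^m$, $\sigma$ is the standard measure on $S^{m-1}$, $B_\varepsilon(x)$ is the ball with center $x$ and radius $\varepsilon$, and $A(S^{m-1})=2\pi^{m/2}/\Gamma(m/2)$. The (renormalized) potential $V^{(\alpha)}_\Omega$ ($\alpha\in\mathbb{R}$) is defined as follows. (i) If $\alpha\le 0$ and $x\in\operatorname{int}\Omega$: for $\alpha<0$, $$V^{(\alpha)}_\Omega(x)=\lim_{\varepsilon\to+0}\left(\int_{\Omega\setminus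 B_\varepsilon(x)}|x-y|^{\alpha-m}\,d\mu(y)-\frac{A(S^{m-1})}{-\alpha}\cdot\frac1{\varepsilon^{-\alpha}}\right),$$ and for $\alpha=0$, $$V^{(0)}_\Omega(x)=\lim_{\varepsilon\to+0}\left(\int_{\Omega\setminus B_\varepsilon(x)}|x-y|^{-m}\,d\mu(y)-A(S^{m-1})\log\frac1\varepsilon\right).$$ (ii) If $\alpha>0$ or $x\notin\Omega$: $V^{(\alpha)}_\Omega(x)=\int_{\Omega}|x-y|^{\alpha-m}\,d\mu(y)$. *)

(* Defs.v *)
From HB Require Import structures.
From mathcomp Require Import all_boot all_order all_algebra.
From mathcomp Require Import all_classical all_reals all_analysis.
From mathcomp Require Import measurable_realfun.

Set Implicit Arguments.
Unset Strict Implicit.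
Unset Printing Implicit Defensive.

Import Order.TTheory GRing.Theory Num.Theory.
Import numFieldNormedType.Exports.

Local Open Scope classical_set_scope.
Local Open Scope ring_scope.

Section rV_measurable.
Context {R : realType} (n : nat).

Let coor (i : 'I_n) (x : 'rV[R]_n) : measurableTypeR R := x ord0 i.

Let rV_set0 : g_sigma_preimage coor set0.
Proof. exact: sigma_algebra0. Qed.

Let rV_setC A : g_sigma_preimage coor A -> g_sigma_preimage coor (~` A).
Proof. exact: sigma_algebraC. Qed.

Let rV_bigcup (F : (set _)^nat) : (forall i, g_sigma_preimage coor (F i)) ->
  g_sigma_preimage coor (\bigcup_i (F i)).
Proof. exact: sigma_algebra_bigcup. Qed.

(* Product of the Borel sigma-algebras of the coordinates, as the library does
   for [n.-tuple]; since R is second countable these are the Borel sets. *)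
HB.instance Definition _ :=
  @isMeasurable.Build (measure_tuple_display (R.-ocitv.-measurable).-sigma)
  'rV[R]_n (g_sigma_preimage coor) rV_set0 rV_setC rV_bigcup.

End rV_measurable.
Lemma measurable_coord (R : realType) n (i : 'I_n) :
  measurable_fun [set: 'rV[R]_n] (fun x : 'rV[R]_n => x ord0 i : R).
Proof.
move=> _ Y mY; rewrite setTI; apply: sub_sigma_algebra => /=.
rewrite -bigcup_seq/=; exists i => /=; first by rewrite mem_index_enum.
by exists Y => //; rewrite setTI.
Qed.

Lemma measurable_fun_rV d (T : measurableType d) (R : realType) n
    (f : T -> 'rV[R]_n) :
  (forall i, measurable_fun setT (fun t => f t ord0 i)) ->
  measurable_fun setT f.
Proof.
move=> mf; suff : g_sigma_preimage (fun i t => f t ord0 i : measurableTypeR R)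
    `<=` measurable.
  have -> : g_sigma_preimage (fun i t => f t ord0 i : measurableTypeR R) =
            preimage_set_system [set: T] f measurable.
    exact: (g_sigma_preimage_comp
      (fun (i : 'I_n) (x : 'rV[R]_n) => x ord0 i : measurableTypeR R)).
  by move=> prefS _ A mA; apply: prefS; exists A.
apply: smallest_sub; first exact: sigma_algebra_measurable.
case: n => [|n] in f mf *; first by rewrite big_ord0.
rewrite -bigcup_mkord_ord; apply: bigcup_sub => i Ii.
by move=> A [B mB <-]; exact: mf.
Qed.

Definition rV_cons {R : realType} {n} (p : R * 'rV[R]_n) : 'rV[R]_n.+1 :=
  row_mx p.1%:M p.2.

Lemma rV_cons0 (R : realType) n (p : R * 'rV[R]_n) : rV_cons p ord0 ord0 = p.1.
Proof.
rewrite mxE; case: splitP => [j _|j /= /eqP]; last by rewrite add1n.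
by rewrite mxE !ord1.
Qed.

Lemma rV_consS (R : realType) n (p : R * 'rV[R]_n) (i : 'I_n) :
  rV_cons p ord0 (lift ord0 i) = p.2 ord0 i.
Proof.
rewrite mxE; case: splitP => [j /= /eqP|j /=].
  by rewrite ord1 /bump leq0n.
by rewrite /bump leq0n !add1n => -[/val_inj ->].
Qed.

Lemma measurable_rV_cons (R : realType) n :
  measurable_fun setT (@rV_cons R n).
Proof.
apply: measurable_fun_rV => i; case: (unliftP ord0 i) => [j|] ->.
  under eq_fun do rewrite rV_consS.
  apply: (@measurableT_comp _ _ _ _ _ _ (fun x : 'rV[R]_n => x ord0 j : R)).
    exact: measurable_coord.
  exact: measurable_snd.
under eq_fun do rewrite rV_cons0.
exact: measurable_fst.
Qed.

Definition rV_uncons {R : realType} {n} (x : 'rV[R]_n.+1) : R * 'rV[R]_n :=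
  (x ord0 ord0, \row_i x ord0 (lift ord0 i)).

Lemma rV_consK (R : realType) n : cancel (@rV_cons R n) rV_uncons.
Proof.
move=> [t u]; rewrite /rV_uncons rV_cons0; congr pair.
by apply/rowP => i; rewrite mxE rV_consS.
Qed.

Lemma measurable_rV_uncons (R : realType) n :
  measurable_fun setT (@rV_uncons R n).
Proof.
apply/measurable_fun_pairP; split; first exact: measurable_coord.
apply: measurable_fun_rV => i; rewrite /comp/=.
by under eq_fun do rewrite mxE; exact: measurable_coord.
Qed.

Section lebesgue_cons.
Local Open Scope ereal_scope.
Context {R : realType} (n : nat).
Variable mu : {sigma_finite_measure set 'rV[R]_n -> \bar R}.

Definition lebesgue_cons : set 'rV[R]_n.+1 -> \bar R :=
  pushforward (lebesgue_measure \x mu) (@rV_cons R n).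

Let mrV_cons : measurable_fun setT (@rV_cons R n) := @measurable_rV_cons R n.

Let lebesgue_cons0 : lebesgue_cons set0 = 0.
Proof. by rewrite /lebesgue_cons /pushforward preimage_set0 measure0. Qed.

Let lebesgue_cons_ge0 A : 0 <= lebesgue_cons A.
Proof. exact: (measure_ge0 (lebesgue_measure \x mu)). Qed.

Let lebesgue_cons_sigma_additive : semi_sigma_additive lebesgue_cons.
Proof.
apply: (@measure_semi_sigma_additive _ _ _ (pushforward _ _)).
exact: mrV_cons.
Qed.

HB.instance Definition _ := isMeasure.Build _ _ _ lebesgue_cons
  lebesgue_cons0 lebesgue_cons_ge0 lebesgue_cons_sigma_additive.

Let lebesgue_cons_sigma_finite : sigma_finite setT lebesgue_cons.
Proof.
have /sigma_finiteP[F [FT ndF Foo]] := sigma_finiteT (@lebesgue_measure R).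
have /sigma_finiteP[G [GT ndG Goo]] := sigma_finiteT mu.
exists (fun k => @rV_uncons R n @^-1` (F k `*` G k)).
  rewrite -preimage_bigcup (_ : \bigcup_k _ = setT) ?preimage_setT//.
  rewrite -subTset => -[t u] _.
  have [i _ Fi] : (\bigcup_k F k) t by rewrite -FT.
  have [j _ Gj] : (\bigcup_k G k) u by rewrite -GT.
  exists (maxn i j) => //; split.
    by move: t Fi; exact/subsetPset/ndF/leq_maxl.
  by move: u Gj; exact/subsetPset/ndG/leq_maxr.
move=> k; have [mFk Fkoo] := Foo k; have [mGk Gkoo] := Goo k.
have mFG : measurable (F k `*` G k) by exact: measurableX.
split.
  by rewrite -[X in measurable X]setTI; exact: measurable_rV_uncons.
rewrite /lebesgue_cons /pushforward -comp_preimage.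
rewrite (_ : rV_uncons \o rV_cons = id); last first.
  by apply/funext => p; exact: rV_consK.
by rewrite preimage_id product_measure1E// lte_mul_pinfty// ge0_fin_numE.
Qed.

HB.instance Definition _ := Measure_isSigmaFinite.Build _ _ _ lebesgue_cons
  lebesgue_cons_sigma_finite.

End lebesgue_cons.

Fixpoint lebesgue_rV {R : realType} (n : nat) :
    {sigma_finite_measure set 'rV[R]_n -> \bar R} :=
  match n with
  | 0 => \d_(0 : 'rV[R]_0)
  | n'.+1 => lebesgue_cons (lebesgue_rV n')
  end.

(* The library norm on ['rV[R]_n] is the sup norm; it is only used here for
   the topology, which is the Euclidean one. *)
Definition enorm {R : realType} {n} (x : 'rV[R]_n) : R :=
  Num.sqrt (\sum_i x ord0 i ^+ 2).

Definition eball {R : realType} {n} (x : 'rV[R]_n) (r : R) : set 'rV[R]_n :=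
  [set y | enorm (y - x) < r].

Definition esphere {R : realType} (n : nat) : set 'rV[R]_n :=
  [set v | enorm v = 1].
Arguments esphere {R} n _.

Lemma measurable_enorm (R : realType) n :
  measurable_fun setT (@enorm R n).
Proof.
apply: (@measurableT_comp _ _ _ _ _ _ (@Num.sqrt R)).
  by apply: continuous_measurable_fun; exact: sqrt_continuous.
by apply: measurable_sum => i; apply: measurable_funX; exact: measurable_coord.
Qed.

Section cap_measure.
Local Open Scope ereal_scope.
Context {R : realType} (n : nat) (s : R).

Let height (u : 'rV[R]_n) : R := Num.sqrt (1 - enorm u ^+ 2).

Let chart (u : 'rV[R]_n) : 'rV[R]_n.+1 := rV_cons (s * height u, u)%R.

Let disk : set 'rV[R]_n := [set u | (enorm u < 1)%R].

(* For s = 1 (resp. -1), surface measure of the open unit half-sphere where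
   the first coordinate is positive (resp. negative), which is the graph of
   [s * height] over the unit disk of R^n.  The area density of a graph is
   [sqrt (1 + |grad|^2)], here [1 / height u]. *)
Definition cap_measure (A : set 'rV[R]_n.+1) : \bar R :=
  \int[lebesgue_rV n]_(u in disk `&` chart @^-1` A) ((height u)^-1)%:E.

Let measurable_height : measurable_fun setT height.
Proof.
apply: (@measurableT_comp _ _ _ _ _ _ (@Num.sqrt R)).
  by apply: continuous_measurable_fun; exact: sqrt_continuous.
apply: measurable_funB => //; apply: measurable_funX.
exact: measurable_enorm.
Qed.

Let measurable_chart : measurable_fun setT chart.
Proof.
apply: (measurableT_comp (@measurable_rV_cons R n)).
apply: measurable_fun_pair => //.
by apply: measurable_funM => //; exact: measurable_height.
Qed.

Let measurable_disk : measurable disk.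
Proof.
rewrite -[X in measurable X]setTI.
rewrite (_ : disk = @enorm R n @^-1` `]-oo, 1%R[).
  by apply: measurable_enorm => //; exact: measurable_itv.
by apply/seteqP; split => u; rewrite /disk /= in_itv.
Qed.

Let measurable_density : measurable_fun setT (fun u => ((height u)^-1)%:E).
Proof.
under eq_fun do rewrite -powR_inv1 ?sqrtr_ge0//.
apply/measurable_EFinP; apply: (measurableT_comp (@measurable_powR R (-1)%R)).
exact: measurable_height.
Qed.

Let cap_measure0 : cap_measure set0 = 0.
Proof. by rewrite /cap_measure preimage_set0 setI0 integral_set0. Qed.

Let cap_measure_ge0 A : 0 <= cap_measure A.
Proof.
by apply: integral_ge0 => u _; rewrite lee_fin invr_ge0 sqrtr_ge0.
Qed.

Let cap_measure_sigma_additive : semi_sigma_additive cap_measure.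
Proof.
move=> F mF tF mUF; rewrite /cap_measure preimage_bigcup setI_bigcupr.
rewrite ge0_integral_bigcup//=.
- apply: is_cvg_nneseries => k _ _.
  by apply: integral_ge0 => u _; rewrite lee_fin invr_ge0 sqrtr_ge0.
- move=> k; apply: measurableI => //.
  by rewrite -[X in measurable X]setTI; exact: measurable_chart.
- exact: measurable_funTS.
- by move=> u _; rewrite lee_fin invr_ge0 sqrtr_ge0.
- apply/trivIsetP => i j _ _ ij.
  move/trivIsetP : tF => /(_ i j Logic.I Logic.I ij) Fij.
  by rewrite setIACA setIid -preimage_setI Fij preimage_set0 setI0.
Qed.

HB.instance Definition _ := isMeasure.Build _ _ _ cap_measure
  cap_measure0 cap_measure_ge0 cap_measure_sigma_additive.

End cap_measure.

(* The equator, where the two caps do not reach, has zero surface measure. *)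
Definition sphere_measure {R : realType} (m : nat) :
    {measure set 'rV[R]_m -> \bar R} :=
  match m with
  | 0 => mzero
  | n.+1 => measure_add (cap_measure 1) (cap_measure (- 1))
  end.

Definition Gamma {R : realType} (a : R) : R :=
  \int[lebesgue_measure]_(t in `]0, +oo[) (t `^ (a - 1) * expR (- t)).

Definition sphere_area {R : realType} (m : nat) : R :=
  2 * pi `^ (m%:R / 2) / Gamma (m%:R / 2).

Definition body {R : realType} {m} (Omega : set 'rV[R]_m) : Prop :=
  compact Omega /\ Omega = closure Omega°.

Definition C1_on {R : realType} {n m} (U : set 'rV[R]_n)
    (f : 'rV[R]_n -> 'rV[R]_m) : Prop :=
  forall p, U p -> differentiable f p /\ {for p, continuous (jacobian f)}.

Definition cube {R : realType} (n : nat) : set 'rV[R]_n :=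
  [set u | forall i, 0 <= u ord0 i <= 1].
Arguments cube {R} n _.

(* The boundary is a finite union of parametrized hypersurface patches in the
   usual sense of vector calculus: each is the image of the closed cube under a
   map that is C^1 on a neighbourhood of it and immersive on its interior; an
   interior point of a patch lies on no other patch and is attained only once
   on its own.  Edges may degenerate, so that cone points, cusps and polar
   coordinates are allowed. *)
Definition piecewise_C1_boundary {R : realType} {m} (Omega : set 'rV[R]_m) :
    Prop :=
  exists (N : nat) (phi : 'I_N -> 'rV[R]_m.-1 -> 'rV[R]_m),
  [/\ closure Omega `\` Omega° = \bigcup_k (phi k @` cube m.-1),
      forall k, exists U : set 'rV[R]_m.-1,
        [/\ open U, cube m.-1 `<=` U & C1_on U (phi k)],
      forall k p, (cube m.-1)° p -> row_free (jacobian (phi k) p) &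
      forall k l p q, (cube m.-1)° p -> cube m.-1 q ->
        phi k p = phi l q -> k = l /\ p = q].

Definition star_shaped {R : realType} {m} (Omega : set 'rV[R]_m)
    (x : 'rV[R]_m) : Prop :=
  forall p, (Omega `\ x) p ->
  forall t : R, 0 <= t <= 1 -> Omega ((1 - t) *: x + t *: p).

Definition radial {R : realType} {m} (M : set 'rV[R]_m) (v : 'rV[R]_m) : R :=
  sup [set a | 0 <= a /\ M (a *: v)].

Section potential.
Local Open Scope ereal_scope.
Context {R : realType} {m : nat}.
Implicit Types (Omega : set 'rV[R]_m) (x : 'rV[R]_m) (alpha eps : R).

Definition riesz_integral alpha Omega x : \bar R :=
  \int[lebesgue_rV m]_(y in Omega) (enorm (x - y) `^ (alpha - m%:R))%:E.

Definition renormalized_integral alpha Omega x eps : \bar R :=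
  riesz_integral alpha (Omega `\` eball x eps) x -
  (if alpha == 0%R then sphere_area m * ln eps^-1
   else sphere_area m / (- alpha) * (1 / eps `^ (- alpha)))%:E.

(* The paper leaves the potential undefined when alpha <= 0 and x is a boundary
   point; the second branch is then a dummy value. *)
Definition potential alpha Omega x : \bar R :=
  if `[< (alpha <= 0)%R /\ Omega° x >]
  then lim (renormalized_integral alpha Omega x eps @[eps --> 0^'+])
  else riesz_integral alpha Omega x.

End potential.

(* Main.v *)
Require Import Defs.
From HB Require Import structures.
From mathcomp Require Import all_boot all_order all_algebra.
From mathcomp Require Import all_classical all_reals all_analysis.
From mathcomp Require Import measurable_realfun ring lra.
Import Order.TTheory GRing.Theory Num.Theory.
Import numFieldNormedType.Exports.
Local Open Scope classical_set_scope.
Local Open Scope ring_scope.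

(** Center polar coordinates at [x].  In direction [v] the set [Omega] is the
    segment of length [rho v], since [Omega] is star-shaped at [x] and closed.
    So the integral of [|x - y| `^ (alpha - m)] over [Omega] without the ball of
    radius [eps] is the integral over the sphere of
    [P (rho v) - P eps], where [P] is a primitive of [r `^ (alpha - 1)], namely
    [r `^ alpha / alpha] or [ln r] ([riesz_integral_shell]).  The term [P eps]
    contributes its product by the area of the sphere, which is what the
    renormalization removes: for small [eps] the renormalized integral does not
    depend on [eps] ([renormalized_integral_near]).  For [alpha > 0] the same
    formula holds at [eps = 0], where [P] vanishes.

    What has to be built is integration in polar coordinates
    ([polar_coordinates]) for Lebesgue measure defined as an iterated product
    and surface measure defined by charts of two open half-spheres.  It is
    obtained one substitution at a time.  Write a point of the half-space as
    [(t, w)] with [t > 0] and let [r] be its norm: for fixed [r] the map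
    [w = r *: u] on the unit disk is a homothety, and for fixed [w] the relation
    [r ^+ 2 = t ^+ 2 + enorm w ^+ 2] gives [t dt = r dr].  The factors [r ^+ n]
    and [r / t] produced in this way are the polar Jacobian and the area density
    of the half-sphere.  As the integrand is the indicator of [Omega] times a
    function, no continuity is available, so the substitutions are identities of
    measures, checked on intervals
    ([ge0_integral_density_pushforward], [ge0_integral_subst_increasing]).

    The area of the sphere is then computed from the Gaussian integral
    ([sphere_measure_esphere]).  Its finiteness, which is part of the outcome,
    makes the bounded functions [P (rho v)] integrable. *)

Set Implicit Arguments.
Unset Strict Implicit.
Unset Printing Implicit Defensive.

(** * Measures given by a density and a map *)

Section weighted_pushforward.
Local Open Scope ereal_scope.
Context d1 d2 (X : measurableType d1) (Y : measurableType d2) (R : realType).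
Variables (mu : {measure set X -> \bar R}) (D : set X) (phi : X -> Y).
Variable (w : X -> R).
Hypotheses (mD : measurable D) (mphi : measurable_fun [set: X] phi).
Hypotheses (mw : measurable_fun D w) (w0 : forall x, D x -> (0 <= w x)%R).

(** The four proofs are arguments so that the measure structure declared below
    can be inferred from the function alone. *)
Definition density_pushforward of measurable D & measurable_fun [set: X] phi &
    measurable_fun D w & (forall x, D x -> (0 <= w x)%R) : set Y -> \bar R :=
  fun A => \int[mu]_(x in D `&` phi @^-1` A) (w x)%:E.

Local Notation nu := (density_pushforward mD mphi mw w0).

Let nu0 : nu set0 = 0.
Proof. by rewrite /density_pushforward preimage_set0 setI0 integral_set0. Qed.

Let nu_ge0 A : 0 <= nu A.
Proof. by apply: integral_ge0 => u [Du _]; rewrite lee_fin w0. Qed.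

Let mpre A : measurable A -> measurable (phi @^-1` A).
Proof. by move=> mA; rewrite -[X in measurable X]setTI; exact: mphi. Qed.

Let nu_sigma_additive : semi_sigma_additive nu.
Proof.
move=> F mF tF mUF; rewrite /density_pushforward preimage_bigcup setI_bigcupr.
rewrite ge0_integral_bigcup//=.
- apply: is_cvg_nneseries => k _ _; apply: integral_ge0 => u [Du _].
  by rewrite lee_fin w0.
- by move=> k; apply: measurableI => //; exact: mpre.
- apply/measurable_EFinP; apply: measurable_funS mw => // x [i _ [] //].
- by move=> u [i _ [Du _]]; rewrite lee_fin w0.
- apply/trivIsetP => i j _ _ ij.
  move/trivIsetP : tF => /(_ i j Logic.I Logic.I ij) Fij.
  by rewrite setIACA setIid -preimage_setI Fij preimage_set0 setI0.
Qed.

HB.instance Definition _ := isMeasure.Build _ _ _ nu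
  nu0 nu_ge0 nu_sigma_additive.

Import HBNNSimple.

Let integral_density_pushforward_nnsfun (h : {nnsfun Y >-> R}) :
  \int[nu]_y (h y)%:E = \int[mu]_(x in D) ((h (phi x))%:E * (w x)%:E).
Proof.
under [in LHS]eq_integral do rewrite fimfunE -fsumEFin//.
rewrite ge0_integral_fsum//; last 2 first.
- by move=> y; exact/measurable_EFinP/measurable_funM.
- by move=> y x _; rewrite nnfun_muleindic_ge0.
transitivity (\int[mu]_(x in D) \sum_(k \in range h)
    ((k * \1_(h @^-1` [set k]) (phi x))%:E * (w x)%:E)); last first.
  apply: eq_integral => x _; rewrite [in RHS]fimfunE -fsumEFin//.
  rewrite ge0_mule_fsuml// => k.
  by rewrite nnfun_muleindic_ge0.
have mind k : measurable_fun D (fun x => \1_(h @^-1` [set k]) (phi x) : R).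
  apply: measurable_funTS; apply: measurableT_comp mphi.
  exact: measurable_indic.
rewrite ge0_integral_fsum//; last 2 first.
- move=> k; apply: emeasurable_funM; last exact/measurable_EFinP.
  by apply/measurable_EFinP/measurable_funM.
- move=> k x Dx; rewrite mule_ge0 ?lee_fin ?w0// -lee_fin.
  by rewrite nnfun_muleindic_ge0.
apply: eq_fsbigr => k /set_mem[y _ hyk].
have k0 : (0 <= k)%R by rewrite -hyk.
rewrite integralZl_indic_nnsfun// integral_indic// setIT.
under [RHS]eq_integral do rewrite EFinM -muleA.
rewrite ge0_integralZl//; last 2 first.
- by apply: emeasurable_funM; exact/measurable_EFinP.
- by move=> x Dx; rewrite mule_ge0 ?lee_fin ?w0.
congr (_ * _).
transitivity (\int[mu]_(x in D `&` phi @^-1` (h @^-1` [set k])) (w x)%:E) => //.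
rewrite integral_mkcondr; apply: eq_integral => x _.
rewrite patchE indicE (_ : (x \in _ @^-1` _) = (phi x \in h @^-1` [set k])) //.
by case: ifPn => _; rewrite ?mul1e ?mul0e.
Qed.

(** Change of variables without any differentiability: both sides are countably
    additive in [g] and agree on indicators by definition.  What is specific to
    a substitution is then to recognise the measure on the left. *)
Lemma ge0_integral_density_pushforward (g : Y -> \bar R) :
  measurable_fun [set: Y] g -> (forall y, 0 <= g y) ->
  \int[nu]_y g y = \int[mu]_(x in D) (g (phi x) * (w x)%:E).
Proof.
move=> mg g0; pose h := nnsfun_approx measurableT mg.
have hg y : (h n y)%:E @[n --> \oo] --> g y.
  exact: (cvg_nnsfun_approx measurableT mg (fun x _ => g0 x)).
have ndh y : {homo (fun n => h n y) : m n / (m <= n)%N >-> (m <= n)%R}.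
  by move=> m n mn; exact/lefP/nd_nnsfun_approx.
transitivity (limn (fun n => \int[nu]_y (h n y)%:E)).
  rewrite -monotone_convergence//.
  - by apply: eq_integral => y _; apply/esym/cvg_lim => //; exact: hg.
  - by move=> n; exact/measurable_EFinP/measurable_funP.
  - by move=> n y _; rewrite lee_fin.
  - by move=> y _ m n mn; rewrite lee_fin; exact: ndh.
rewrite (_ : (fun n => _) =
    (fun n => \int[mu]_(x in D) ((h n (phi x))%:E * (w x)%:E))); last first.
  by apply/funext => n; exact: integral_density_pushforward_nnsfun.
rewrite -monotone_convergence//.
- apply: eq_integral => x _; apply/cvg_lim => //.
  by apply: cvgeZr => //; exact: hg.
- move=> n; apply: emeasurable_funM; last exact/measurable_EFinP.
  by apply/measurable_funTS/measurable_EFinP; exact: measurableT_comp mphi.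
- by move=> n x Dx; rewrite mule_ge0 ?lee_fin ?w0.
- by move=> x Dx m n mn; rewrite lee_wpmul2r ?lee_fin ?w0//; exact: ndh.
Qed.

End weighted_pushforward.

(** * Improper substitution on the half line *)

Section calculus.
Context {R : realType}.
Implicit Types (F f G : R -> R) (a b : R).
Local Notation mu := (@lebesgue_measure R).

(** The integrand may blow up at the left end point: the formula holds on the
    compact intervals [a + (b - a) / (n + 2), b], and monotone convergence
    carries it to their union.  Powers with a negative exponent near 0 and
    the density of the substitution of a leg for the hypotenuse both need
    this. *)
Lemma ge0_FTC_itvoc F f a b : a <= b -> F x @[x --> a^'+] --> F a ->
  (forall x, a < x -> is_derive x (1 : R) F (f x)) ->
  (forall x, a < x -> {for x, continuous f}) ->
  (forall x, a < x -> 0 <= f x) ->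
  (\int[mu]_(x in `]a, b]) (f x)%:E = (F b - F a)%:E)%E.
Proof.
rewrite le_eqVlt => /predU1P[<- _ _ _ _|ab Fa dF cf f0].
  by rewrite set_itvoc0 integral_set0 subrr.
have mf : measurable_fun `]a, +oo[ f.
  apply: open_continuous_measurable_fun => // x /set_mem.
  by rewrite /= in_itv/= andbT => /cf.
pose u n : R := a + (b - a) / n.+2%:R.
have ba0 : 0 < b - a by rewrite subr_gt0.
have ua n : a < u n by rewrite ltrDl divr_gt0.
have ub n : u n < b.
  by rewrite -ltrBrDl ltr_pdivrMr// ltr_pMr// ltr1n.
have cvgu : u n @[n --> \oo] --> a.
  rewrite -[X in _ --> X]addr0; apply: cvgD; first exact: cvg_cst.
  rewrite -[X in _ --> X](mulr0 (b - a)); apply: cvgM; first exact: cvg_cst.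
  by move: (@cvg_harmonic R); rewrite -cvg_shiftS.
have subu n : `[u n, b] `<=` `]a, +oo[.
  by move=> x /=; rewrite !in_itv/= andbT => /andP[+ _]; exact: lt_le_trans.
have intu n : (\int[mu]_(x in `[u n, b]) (f x)%:E = (F b)%:E - (F (u n))%:E)%E.
  apply: continuous_FTC2 => //.
  - apply: continuous_in_subspaceT => x /set_mem /subu /=.
    by rewrite in_itv/= andbT => /cf.
  - have cF x : a < x -> {for x, continuous F}.
      by move=> /dF[dFx _]; apply/differentiable_continuous/derivable1_diffP.
    split.
    + by move=> x; rewrite in_itv/= => /andP[/(lt_trans (ua n)) /dF[]].
    + exact/cvg_at_right_filter/cF.
    + exact/cvg_at_left_filter/cF.
  - move=> x xub.
    have ax : a < x by move: xub; rewrite in_itv/= => /andP[/(lt_trans (ua n))].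
    by rewrite derive1E; exact: (@derive_val _ _ _ _ _ _ _ (dF x ax)).
have ndu : nondecreasing_seq (fun n => `[u n, b]%classic).
  apply/nondecreasing_seqP => n; apply/subsetPset => x /=.
  rewrite !in_itv/= => /andP[ux ->]; rewrite andbT (le_trans _ ux)// lerD2l.
  by rewrite ler_pM2l// lef_pV2 ?posrE// ler_nat.
have -> : `]a, b]%classic = \bigcup_n `[u n, b]%classic.
  apply/seteqP; split => x /=; last first.
    move=> [n _] /=; rewrite !in_itv/= => /andP[ux ->].
    by rewrite (lt_le_trans _ ux).
  rewrite in_itv/= => /andP[ax xb].
  have /cvgrPdist_lt/(_ (x - a)) := cvgu; rewrite subr_gt0 => /(_ ax)[n _ /(_ n)].
  move=> /(_ (leqnn _))/= un; exists n => //=; rewrite in_itv/= xb andbT ltW//.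
  by move: un; rewrite ltr_norml => /andP[+ _]; rewrite opprB ltrD2l ltrN2.
have : (\int[mu]_(x in `[u n, b]%classic) (f x)%:E)%E @[n --> \oo] -->
    (\int[mu]_(x in \bigcup_n `[u n, b]%classic) (f x)%:E)%E.
  apply: (@ge0_nondecreasing_set_cvg_integral _ (measurableTypeR R)) => //.
  - by move=> n; apply/measurable_EFinP; exact: measurable_funS mf.
  - by move=> n x /subu/=; rewrite in_itv/= andbT lee_fin => /f0.
move/cvg_lim => <- //; apply/cvg_lim => //=.
under eq_fun do rewrite intu -EFinB.
apply: cvg_EFin; first exact: nearW.
apply: cvgB; first exact: cvg_cst.
by move/cvg_at_rightP : Fa; apply.
Qed.

(** Substitution [t = F x] for a merely measurable [g].  By uniqueness of
    Lebesgue measure it is enough to know the measure with density [f] of the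
    preimage under [F] of an interval ]b, c]: that preimage is ]G b, G c], of
    measure [F (G c) - F (G b) = c - b].  The inverse [G] is described by the
    Galois connection with [F], which spares its continuity. *)
Lemma ge0_integral_subst_increasing F f G a (g : R -> \bar R) :
  F x @[x --> a^'+] --> F a ->
  (forall x, a < x -> is_derive x (1 : R) F (f x)) ->
  (forall x, a < x -> {for x, continuous f}) ->
  (forall x, a < x -> 0 <= f x) ->
  measurable_fun [set: R] F ->
  G 0 = a -> (forall t, 0 <= t -> a <= G t) ->
  (forall t, 0 <= t -> F (G t) = t) ->
  (forall x t, a < x -> 0 <= t -> (F x <= t) = (x <= G t)) ->
  measurable_fun [set: R] g -> (forall t, 0 <= g t)%E ->
  (\int[mu]_(t in `]0%R, +oo[) g t =
   \int[mu]_(x in `]a, +oo[) (g (F x) * (f x)%:E))%E.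
Proof.
move=> Fa dF cf f0 mF G0 aG FG FleG mg g0.
have mD : measurable (`]a, +oo[%classic : set R) by exact: measurable_itv.
have mf : measurable_fun `]a, +oo[ f.
  apply: open_continuous_measurable_fun => // x /set_mem.
  by rewrite /= in_itv/= andbT => /cf.
have f0' x : `]a, +oo[%classic x -> 0 <= f x.
  by rewrite /= in_itv/= andbT => /f0.
pose nu : {measure set (measurableTypeR R) -> \bar R} :=
  @density_pushforward _ _ (measurableTypeR R) (measurableTypeR R) R mu
    _ _ _ mD mF mf f0'.
have nuitv b c : 0 <= b -> b <= c -> nu `]b, c]%classic = (c - b)%:E.
  move=> b0 bc; have c0 := le_trans b0 bc; rewrite /nu /= /density_pushforward.
  rewrite (_ : _ `&` _ = `]G b, G c]%classic); last first.
    apply/seteqP; split => x /=; rewrite !in_itv/= ?andbT.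
      by move=> [ax]; rewrite !ltNge !FleG.
    move=> /andP[Gbx xGc]; have ax := le_lt_trans (aG _ b0) Gbx.
    by split => //; rewrite ltNge !FleG// -ltNge Gbx.
  have GbGc : G b <= G c.
    have := aG _ b0; rewrite le_eqVlt => /predU1P[<-|aGb]; first exact: aG.
    by rewrite -FleG// FG.
  transitivity (F (G c) - F (G b))%:E; last by rewrite !FG.
  apply: ge0_FTC_itvoc => //.
  - have := aG _ b0; rewrite le_eqVlt => /predU1P[<-//|aGb].
    apply: cvg_at_right_filter; apply: differentiable_continuous.
    by apply/derivable1_diffP; case: (dF _ aGb).
  - by move=> x Gbx; apply: dF; exact: le_lt_trans (aG _ b0) Gbx.
  - by move=> x Gbx; apply: cf; exact: le_lt_trans (aG _ b0) Gbx.
  - by move=> x Gbx; apply: f0; exact: le_lt_trans (aG _ b0) Gbx.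
have nu_neg b c : c <= 0 -> nu `]b, c]%classic = 0%E.
  move=> c0; rewrite /nu /= /density_pushforward.
  rewrite (_ : _ `&` _ = set0) ?integral_set0//.
  apply/seteqP; split => x //=; rewrite !in_itv/= andbT => -[ax /andP[_]].
  by move=> /le_trans /(_ c0); rewrite FleG// G0 leNgt ax.
(* The pushforward lives on ]0, +oo[; uniqueness of Lebesgue measure is about
   the whole line, hence the restriction to ]-oo, 0] added to it. *)
have mNy : measurable (`]-oo, 0%R] : set (measurableTypeR R)).
  exact: measurable_itv.
pose m : {measure set (measurableTypeR R) -> \bar R} :=
  measure_add nu (mrestr mu mNy).
have mD' A : m A = (nu A + mu (A `&` `]-oo, 0%R]))%E by exact: measure_addE.
have mE A : measurable A -> mu A = m A.
  apply: lebesgue_measure_unique => _ /ocitvP[->|[[b c] /= bc ->]].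
    by rewrite !measure0.
  rewrite mD'; have [c0|c0] := leP c 0.
    rewrite nu_neg// add0e; congr (mu _); apply/seteqP; split => x /=.
      by rewrite !in_itv/= => /andP[-> xc]; rewrite xc (le_trans xc).
    by case.
  have [b0|b0] := leP 0 b.
    rewrite nuitv//; last exact: ltW.
    rewrite (_ : _ `&` _ = set0) ?measure0 ?adde0.
      by rewrite lebesgue_measure_itv/= lte_fin bc EFinB.
    apply/seteqP; split => x //=; rewrite !in_itv/= => -[/andP[bx _] x0].
    by have := lt_le_trans (le_lt_trans b0 bx) x0; rewrite ltxx.
  have -> : nu `]b, c]%classic = c%:E.
    rewrite (@itv_bndbnd_setU _ _ _ (BRight 0)) ?bnd_simp ?ltW//.
    transitivity (nu `]b, 0%R]%classic + nu `]0%R, c]%classic)%E.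
      apply: measureU; [exact: measurable_itv|exact: measurable_itv|].
      apply/seteqP; split => x //=; rewrite !in_itv/= => -[/andP[_ x0] /andP[]].
      by rewrite ltNge x0.
    by rewrite nu_neg// nuitv// ?ltW// add0e subr0.
  have -> : `]b, c] `&` `]-oo, 0%R] = `]b, 0%R]%classic.
    apply/seteqP; split => x /=; rewrite !in_itv/=.
      by move=> [/andP[-> _] ->].
    by move=> /andP[-> x0]; rewrite x0 (le_trans x0) ?ltW.
  rewrite !lebesgue_measure_itv/= !lte_fin bc b0.
  by rewrite -!EFinB -EFinD sub0r.
have mEpos (A : set (measurableTypeR R)) :
    measurable A -> A `<=` [set` `]0%R, +oo[] -> mu A = nu A.
  move=> mA A0; rewrite mE// mD' (_ : _ `&` _ = set0) ?measure0 ?adde0//.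
  apply/seteqP; split => x //= -[/A0]/=.
  by rewrite !in_itv/= andbT ltNge => /negP.
have mP : measurable (`]0%R, +oo[%classic : set R) by exact: measurable_itv.
rewrite (eq_measure_integral nu); last by move=> A mA A0; exact: mEpos.
rewrite integral_mkcond ge0_integral_density_pushforward; last 2 first.
- by apply/(measurable_restrictT _ mP); exact: measurable_funTS.
- by move=> t; exact: erestrict_ge0.
apply: eq_integral => x; rewrite inE/= in_itv/= andbT => ax.
by rewrite patchE mem_set//= in_itv/= andbT ltNge FleG// G0 -ltNge.
Qed.

End calculus.

(** * Lebesgue measure on row vectors *)

Section one_dim.
Context {R : realType}.
Local Notation mu := (@lebesgue_measure R).
Local Open Scope ereal_scope.

Lemma ge0_integral_affine (c b : R) (g : R -> \bar R) : (0 < c)%R ->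
  measurable_fun [set: R] g -> (forall t, 0 <= g t) ->
  c%:E * \int[mu]_t g (c * t + b)%R = \int[mu]_t g t.
Proof.
move=> c0 mg g0.
pose phi (t : measurableTypeR R) : measurableTypeR R := (c * t + b)%R.
have mphi : measurable_fun setT phi.
  by apply: measurable_funD => //; exact: measurable_funM.
have mw : measurable_fun [set: measurableTypeR R] (fun=> c).
  exact: measurable_cst.
pose m : {measure set (measurableTypeR R) -> \bar R} :=
  @density_pushforward _ _ _ _ R mu _ _ _ measurableT mphi mw
    (fun _ _ => ltW c0).
have mE A : measurable A -> mu A = m A.
  apply: lebesgue_measure_unique => _ /ocitvP[->|[[u v] /= uv ->]].
    by rewrite !measure0.
  rewrite /m /= /density_pushforward setTI integral_cst//=; last first.
    by rewrite -[X in measurable X]setTI; exact: (mphi measurableT).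
  rewrite (_ : _ @^-1` _ = `](u - b) / c, (v - b) / c]%classic)%R; last first.
    apply/seteqP; split => x /=; rewrite !in_itv/=.
      rewrite ltr_pdivrMr// ler_pdivlMr// ltrBlDr lerBrDr.
      by rewrite mulrC.
    rewrite ltr_pdivrMr// ler_pdivlMr// ltrBlDr lerBrDr.
    by rewrite mulrC.
  rewrite !lebesgue_measure_itv/= !lte_fin uv ltr_pM2r ?invr_gt0// ltrD2r uv.
  rewrite -!EFinB -EFinM -mulrBl mulrC mulfVK ?gt_eqF//.
  by rewrite opprB addrA subrK.
rewrite [RHS](eq_measure_integral m) => [|A mA _]; last exact: mE.
rewrite /m ge0_integral_density_pushforward//.
rewrite -ge0_integralZl//.
- by apply: eq_integral => t _; rewrite muleC.
- exact: measurableT_comp mg mphi.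
- by rewrite lee_fin ltW.
Qed.

Lemma ge0_integral_opp (g : R -> \bar R) :
  measurable_fun [set: R] g -> (forall t, 0 <= g t) ->
  \int[mu]_(t in `]0%R, +oo[) g (- t)%R = \int[mu]_(t in `]-oo, 0%R[) g t.
Proof.
move=> mg g0; rewrite [RHS]integral_mkcond [LHS]integral_mkcond.
pose phi (t : measurableTypeR R) : measurableTypeR R := (- t)%R.
have mphi : measurable_fun setT phi by exact: oppr_measurable.
have mw : measurable_fun [set: measurableTypeR R] (fun=> 1%R : R).
  exact: measurable_cst.
pose m : {measure set (measurableTypeR R) -> \bar R} :=
  @density_pushforward _ _ _ _ R mu _ _ _ measurableT mphi mw
    (fun _ _ => ler01).
rewrite [RHS](eq_measure_integral m) => [|A mA _]; last first.
  transitivity (pushforward mu phi A); first exact/esym/lebesgue_measureN.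
  rewrite /m /= /density_pushforward setTI integral_cst//= ?mul1e//.
  by rewrite -[X in measurable X]setTI; exact: (mphi measurableT).
rewrite /m ge0_integral_density_pushforward//; last 2 first.
- have mN : measurable (`]-oo, 0%R[%classic : set R) by exact: measurable_itv.
  apply/(measurable_restrictT _ mN).
  exact: measurable_funTS.
- by move=> t; exact: erestrict_ge0.
apply: eq_integral => x _; rewrite mule1 !patchE /phi.
by rewrite !mem_setE !in_itv/= andbT oppr_lt0.
Qed.

Lemma ge0_integral_split0 (g : R -> \bar R) :
  measurable_fun [set: R] g -> (forall t, 0 <= g t) ->
  \int[mu]_t g t =
  \int[mu]_(t in `]0%R, +oo[) g t + \int[mu]_(t in `]0%R, +oo[) g (- t)%R.
Proof.
move=> mg g0; rewrite ge0_integral_opp//.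
have mN : measurable (`]-oo, 0%R[%classic : set R) by exact: measurable_itv.
have mP : measurable (`[0%R, +oo[%classic : set R) by exact: measurable_itv.
have -> : [set: R] = `]-oo, 0%R[%classic `|` `[0%R, +oo[%classic.
  apply/seteqP; split => x //= _; rewrite !in_itv/= andbT.
  by have [x0|x0] := ltP x 0%R; [left|right].
rewrite ge0_integral_setU//=; last 2 first.
- exact: measurable_funTS.
- apply/disj_setPS => x [] /=; rewrite !in_itv/= andbT => x0.
  by rewrite leNgt x0.
by rewrite addeC integral_itv_obnd_cbnd//; exact: measurable_funTS.
Qed.

End one_dim.

Section rV.
Context {R : realType}.
Local Notation mu := (@lebesgue_measure R).
Local Open Scope ereal_scope.

Lemma ge0_integral_rV_cons n (f : 'rV[R]_n.+1 -> \bar R) :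
  measurable_fun setT f -> (forall y, 0 <= f y) ->
  \int[lebesgue_rV n.+1]_y f y =
  \int[lebesgue_rV n]_w \int[mu]_t f (rV_cons (t, w)).
Proof.
move=> mf f0.
transitivity (\int[lebesgue_measure \x lebesgue_rV n]_p f (rV_cons p)).
  have := @ge0_integral_pushforward _ _ (measurableTypeR R * 'rV[R]_n)%type
    'rV[R]_n.+1 R _ (@measurable_rV_cons R n)
    (lebesgue_measure \x lebesgue_rV n) setT f measurableT mf (fun y _ => f0 y).
  rewrite preimage_setT => <-.
  by apply: eq_measure_integral => [|A mA _]; first exact: measurable_rV_cons.
apply: (@fubini_tonelli2 _ _ (measurableTypeR R) 'rV[R]_n R lebesgue_measure
  (lebesgue_rV n) (f \o @rV_cons R n)).
- exact: measurableT_comp mf (@measurable_rV_cons R n).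
- by move=> p; exact: f0.
Qed.

Lemma measurable_integral_rV_cons n (f : 'rV[R]_n.+1 -> \bar R) :
  measurable_fun setT f -> (forall y, 0 <= f y) ->
  measurable_fun setT (fun w => \int[mu]_t f (rV_cons (t, w))).
Proof.
move=> mf f0; apply: (@measurable_fun_fubini_tonelli_G _ _ (measurableTypeR R)
  'rV[R]_n R lebesgue_measure (f \o @rV_cons R n)).
- exact: measurableT_comp mf (@measurable_rV_cons R n).
- by move=> p; exact: f0.
Qed.

Lemma measurable_rV_add d (T : measurableType d) n (u b : T -> 'rV[R]_n) :
  measurable_fun setT u -> measurable_fun setT b ->
  measurable_fun setT (fun t => u t + b t)%R.
Proof.
move=> mv mb; apply: measurable_fun_rV => i; under eq_fun do rewrite mxE.
by apply: measurable_funD; [exact: measurableT_comp (measurable_coord i) mv|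
  exact: measurableT_comp (measurable_coord i) mb].
Qed.

Lemma measurable_rV_scale d (T : measurableType d) n (c : T -> R)
    (u : T -> 'rV[R]_n) :
  measurable_fun setT c -> measurable_fun setT u ->
  measurable_fun setT (fun t => c t *: u t)%R.
Proof.
move=> mc mv; apply: measurable_fun_rV => i; under eq_fun do rewrite mxE.
by apply: measurable_funM => //; exact: measurableT_comp (measurable_coord i) mv.
Qed.

(** Induction on the dimension: Tonelli peels off the first coordinate, on which
    the one-dimensional scaling contributes one factor [c]. *)
Lemma ge0_integral_rV_affine n (c : R) (b : 'rV[R]_n) (f : 'rV[R]_n -> \bar R) :
  (0 < c)%R -> measurable_fun setT f -> (forall y, 0 <= f y) ->
  (c ^+ n)%:E * \int[lebesgue_rV n]_y f (c *: y + b)%R =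
  \int[lebesgue_rV n]_y f y.
Proof.
move=> c0; elim: n b f => [|n IHn] b f mf f0.
  by rewrite expr0 mul1e; apply: eq_integral => y _; congr f; apply/rowP => -[].
have mfa : measurable_fun setT (fun y : 'rV[R]_n.+1 => f (c *: y + b)%R).
  apply: measurableT_comp mf _; apply: measurable_rV_add => //.
  exact: measurable_rV_scale.
rewrite !ge0_integral_rV_cons//.
pose b' : 'rV[R]_n := (rV_uncons b).2.
have consE t w : (c *: rV_cons (t, w) + b)%R =
    rV_cons ((c * t + b ord0 ord0)%R, (c *: w + b')%R).
  apply/rowP => i; case: (unliftP ord0 i) => [j|] ->.
    by rewrite rV_consS 2!mxE rV_consS !mxE.
  by rewrite rV_cons0 2!mxE rV_cons0.
have mfc w : measurable_fun setT (fun t => f (rV_cons (t, w))).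
  apply: measurableT_comp mf _; apply: measurableT_comp (@measurable_rV_cons R n) _.
  exact: measurable_pair2.
rewrite exprSr EFinM -muleA.
under [in LHS]eq_integral do under eq_integral do rewrite consE.
rewrite -ge0_integralZl//; first last.
- by rewrite lee_fin ltW.
- by move=> w _; exact: integral_ge0.
- have := measurable_integral_rV_cons mfa (fun y => f0 _).
  by under eq_fun do under eq_integral do rewrite consE.
under eq_integral do rewrite (ge0_integral_affine _ c0 (mfc _)) //.
apply: (IHn b' (fun w => \int[mu]_t f (rV_cons (t, w)))).
- exact: measurable_integral_rV_cons.
- by move=> w; exact: integral_ge0.
Qed.

(** The sigma-algebra of ['rV[R]_n] is generated by the coordinates, so openness
    gives measurability only through a countable base: an open set is the union
    of the cubes with rational centre and radius [1 / k.+1] that it contains. *)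
Lemma open_measurable_rV n (U : set 'rV[R]_n) : open U -> measurable U.
Proof.
move=> oU.
pose box (q : 'rV[rat]_n) (k : nat) : set 'rV[R]_n :=
  [set y | forall i, (`|ratr (q ord0 i) - y ord0 i| < k.+1%:R^-1)%R].
pose F (p : 'rV[rat]_n * nat) : set 'rV[R]_n :=
  if pselect (box p.1 p.2 `<=` U) then box p.1 p.2 else set0.
have mbox q k : measurable (box q k).
  rewrite (_ : box q k = \bigcap_(i in [set: 'I_n]) ((fun y => y ord0 i) @^-1`
      [set x : R | (`|ratr (q ord0 i) - x| < k.+1%:R^-1)%R])); last first.
    by apply/seteqP; split => y /= h i; [move=> _|]; exact: h.
  apply: fin_bigcap_measurable => // i _.
  rewrite -[X in measurable X]setTI; apply: measurable_coord => //.
  exact: measurable_ball.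
rewrite (_ : U = \bigcup_p F p).
  apply: countable_bigcupT_measurable => [|p]; first exact: countableP.
  by rewrite /F; case: pselect => h /=; [exact: mbox|exact: measurable0].
apply/seteqP; split => [y Uy|y [p _]]; last first.
  by rewrite /F; case: pselect => pU /=; [move=> /pU|].
have /nbhs_ballP[e /= e0 yeU] := open_nbhs_nbhs (conj oU Uy).
(* Two cube radii have to fit in the ball: from [y] to the rational centre,
   and from the centre to any point of the cube. *)
pose k := Num.truncn (2 / e)%R.
have k2 : (k.+1%:R^-1 + k.+1%:R^-1 < e)%R.
  rewrite -mulr2n -[X in (X < _)%R]mulr_natl ltr_pdivrMr// mulrC -ltr_pdivrMr//.
  exact: (Num.Theory.truncnS_gt).
have /choice[q qy] i : exists q : rat, (`|ratr q - y ord0 i| < k.+1%:R^-1)%R.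
  have /rat_in_itvoo[q] : (y ord0 i - k.+1%:R^-1 < y ord0 i + k.+1%:R^-1)%R.
    by rewrite ltrBlDr -addrA ltrDl addr_gt0.
  by rewrite in_itv/= => yq; exists q; rewrite ltr_distl.
have qyE i : (`|ratr ((\row_i q i) ord0 i) - y ord0 i| < k.+1%:R^-1)%R.
  by rewrite mxE.
exists (\row_i q i, k) => //; rewrite /F; case: pselect => h /=.
  exact: qyE.
exfalso.
apply: h => z zq; apply: yeU; split => // i j; rewrite (ord1 i) /ball /=.
rewrite (le_lt_trans _ k2)// (le_trans (ler_distD (ratr (q j)) _ _))//.
rewrite lerD//; first by rewrite distrC ltW.
by have := zq j; rewrite mxE => /ltW.
Qed.

Lemma closed_measurable_rV n (U : set 'rV[R]_n) : closed U -> measurable U.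
Proof.
move=> cU; rewrite -(setCK U); apply: measurableC.
by apply: open_measurable_rV; exact: closed_openC.
Qed.

End rV.

(** * The caps of the sphere as weighted images of the disk *)

Section enorm.
Context {R : realType} {n : nat}.
Implicit Types (u : 'rV[R]_n) (c : R).

Lemma enorm_ge0 u : 0 <= enorm u.
Proof. exact: sqrtr_ge0. Qed.

Lemma sqr_enorm u : enorm u ^+ 2 = \sum_i u ord0 i ^+ 2.
Proof. by rewrite sqr_sqrtr// sumr_ge0// => i _; exact: sqr_ge0. Qed.

Lemma enormZ c u : enorm (c *: u) = `|c| * enorm u.
Proof.
rewrite /enorm -sqrtr_sqr -sqrtrM ?sqr_ge0// mulr_sumr.
by congr Num.sqrt; apply: eq_bigr => i _; rewrite mxE exprMn.
Qed.

End enorm.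

Lemma sqr_enorm_cons (R : realType) n (t : R) (u : 'rV[R]_n) :
  enorm (rV_cons (t, u)) ^+ 2 = t ^+ 2 + enorm u ^+ 2.
Proof.
rewrite !sqr_enorm big_ord_recl rV_cons0; congr (_ + _).
by apply: eq_bigr => i _; rewrite rV_consS.
Qed.

Lemma scale_rV_cons (R : realType) n (c t : R) (u : 'rV[R]_n) :
  c *: rV_cons (t, u) = rV_cons (c * t, c *: u).
Proof.
apply/rowP => i; case: (unliftP ord0 i) => [j|] ->.
  by rewrite mxE !rV_consS mxE.
by rewrite mxE !rV_cons0.
Qed.

Section cap.
Context {R : realType} (n : nat).
Implicit Types (s r t : R) (u w : 'rV[R]_n).
Local Notation mu := (@lebesgue_measure R).
Local Notation N := (@lebesgue_rV R n).

Definition cap_height u : R := Num.sqrt (1 - enorm u ^+ 2).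

Definition cap_chart s u : 'rV[R]_n.+1 := rV_cons (s * cap_height u, u).

Definition unit_disk : set 'rV[R]_n := [set u | enorm u < 1].

Lemma measurable_cap_height : measurable_fun setT cap_height.
Proof.
apply: (@measurableT_comp _ _ _ _ _ _ (@Num.sqrt R)).
  by apply: continuous_measurable_fun; exact: sqrt_continuous.
by apply: measurable_funB => //; apply: measurable_funX; exact: measurable_enorm.
Qed.

Lemma measurable_cap_chart s : measurable_fun setT (cap_chart s).
Proof.
apply: (measurableT_comp (@measurable_rV_cons R n)).
apply: measurable_fun_pair => //.
by apply: measurable_funM => //; exact: measurable_cap_height.
Qed.

Lemma measurable_unit_disk : measurable unit_disk.
Proof.
rewrite -[X in measurable X]setTI.
rewrite (_ : unit_disk = @enorm R n @^-1` `]-oo, 1%R[).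
  by apply: measurable_enorm => //; exact: measurable_itv.
by apply/seteqP; split => u; rewrite /unit_disk /= in_itv.
Qed.

Lemma measurable_cap_heightV :
  measurable_fun unit_disk (fun u => (cap_height u)^-1).
Proof.
apply: measurable_funTS.
under eq_fun do rewrite -powR_inv1 ?sqrtr_ge0//.
by apply: (measurableT_comp (measurable_powR (-1)%R)); exact: measurable_cap_height.
Qed.

(** The surface measure of a cap is the image of the disk under the chart with
    the area density of a graph, so integrals over it are integrals over the
    disk. *)
Lemma ge0_integral_cap s (g : 'rV[R]_n.+1 -> \bar R) :
  measurable_fun setT g -> (forall v, (0 <= g v)%E) ->
  (\int[cap_measure s]_v g v =
   \int[N]_(u in unit_disk) (g (cap_chart s u) * ((cap_height u)^-1)%:E))%E.
Proof.
move=> mg g0.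
have h0 u : unit_disk u -> 0 <= (cap_height u)^-1 by rewrite invr_ge0 sqrtr_ge0.
rewrite (eq_measure_integral (density_pushforward N measurable_unit_disk
  (measurable_cap_chart s) measurable_cap_heightV h0)); last by [].
by rewrite ge0_integral_density_pushforward.
Qed.

End cap.

(** * Polar coordinates *)

Section polar.
Context {R : realType}.
Local Notation mu := (@lebesgue_measure R).

(** In a right triangle with legs [a] and [t] and hypotenuse [r], where [a] is
    fixed, [t dt = r dr]. *)
Lemma ge0_integral_subst_leg (a : R) (g : R -> \bar R) : 0 <= a ->
  measurable_fun [set: R] g -> (forall t, 0 <= g t)%E ->
  (\int[mu]_(t in `]0%R, +oo[) g t =
   \int[mu]_(r in `]a, +oo[)
     (g (Num.sqrt (r ^+ 2 - a ^+ 2)) * (r / Num.sqrt (r ^+ 2 - a ^+ 2))%:E))%E.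
Proof.
move=> a0 mg g0.
have sqr_gt r : a < r -> 0 < r ^+ 2 - a ^+ 2.
  by move=> ar; rewrite subr_gt0 ltr_pXn2r// ?nnegrE ?(le_trans a0) ?ltW.
have cF : continuous (fun r : R => Num.sqrt (r ^+ 2 - a ^+ 2)).
  move=> r; apply: (@continuous_comp R R R (fun r => r ^+ 2 - a ^+ 2) (@Num.sqrt R)).
    by apply: cvgB; [exact: exprn_continuous|exact: cvg_cst].
  exact: sqrt_continuous.
apply: (@ge0_integral_subst_increasing _ (fun r => Num.sqrt (r ^+ 2 - a ^+ 2))
   (fun r => r / Num.sqrt (r ^+ 2 - a ^+ 2))
   (fun t => Num.sqrt (t ^+ 2 + a ^+ 2))) => //.
- by apply: cvg_at_right_filter; exact: cF.
- move=> r ar.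
  have ds := @is_derive1_sqrt R (r ^+ 2 - a ^+ 2) (sqr_gt r ar).
  have dq : is_derive r (1 : R) (fun r => r ^+ 2 - a ^+ 2) (2 * r).
    apply: (is_derive_eq (is_deriveB (is_deriveX 2 (is_derive_id r (1 : R)))
      (is_derive_cst (a ^+ 2) r (1 : R)))).
    by rewrite subr0 expr1 [LHS]mulr1.
  have := @is_derive1_comp R _ (fun r => r ^+ 2 - a ^+ 2) r _ _ ds dq.
  rewrite (_ : _ * (2 * r) = r / Num.sqrt (r ^+ 2 - a ^+ 2))//.
  by rewrite mulrC invfM mulrACA divff// mul1r.
- move=> r ar; apply: cvgM; first exact: cvg_id.
  by apply: cvgV; [rewrite sqrtr_eq0 -ltNge sqr_gt|exact: cF].
- by move=> r ar; rewrite divr_ge0 ?sqrtr_ge0// (le_trans a0)// ltW.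
- exact: continuous_measurable_fun.
- by rewrite expr0n add0r sqrtr_sqr ger0_norm.
- move=> t t0; rewrite -[leLHS](ger0_norm a0) -sqrtr_sqr ler_wsqrtr// lerDr.
  exact: sqr_ge0.
- move=> t t0; rewrite sqr_sqrtr ?addr_ge0 ?sqr_ge0//.
  by rewrite addrK sqrtr_sqr ger0_norm.
- move=> r t ar t0; have r0 := le_trans a0 (ltW ar).
  rewrite -[X in _ <= X](ger0_norm t0) -sqrtr_sqr ler_sqrt ?sqr_ge0//.
  rewrite -[in RHS](ger0_norm r0) -[in RHS]sqrtr_sqr ler_sqrt ?addr_ge0 ?sqr_ge0//.
  by rewrite lerBlDr.
Qed.

End polar.

Lemma measurable_section_integral (R : realType) d (T : measurableType d)
    (g : T * measurableTypeR R -> \bar R) (D : set (measurableTypeR R)) :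
  measurable D -> measurable_fun setT g ->
  (forall x t, D t -> (0 <= g (x, t))%E) ->
  measurable_fun setT (fun x => \int[@lebesgue_measure R]_(t in D) g (x, t))%E.
Proof.
move=> mD mg g0; pose TD : set (T * measurableTypeR R) := [set: T] `*` D.
have mTD : measurable TD by exact: measurableX.
have gD0 p : (0 <= (g \_ TD) p)%E.
  by apply: erestrict_ge0 => -[x t] [_ Dt]; exact: g0.
have mgD : measurable_fun setT (g \_ TD).
  by apply/(measurable_restrictT _ mTD); exact: measurable_funTS.
have := @measurable_fun_fubini_tonelli_F _ _ T (measurableTypeR R) R
  (@lebesgue_measure R) _ mgD gD0.
apply: eq_measurable_fun => x _; rewrite /fubini_F [RHS]integral_mkcond.
apply: eq_integral => t _; rewrite !patchE.
by congr (if _ then _ else _); apply/idP/idP; rewrite !inE /TD /=; [case|split].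
Qed.

Section polar_cap.
Context {R : realType} (n : nat) (s : R) (f : 'rV[R]_n.+1 -> \bar R).
Hypotheses (mf : measurable_fun setT f) (f0 : forall y, (0 <= f y)%E).
Local Notation mu := (@lebesgue_measure R).
Local Notation N := (@lebesgue_rV R n).
Local Open Scope ereal_scope.

Let mR := measurableTypeR R.

Let leg (r : R) (w : 'rV[R]_n) : R := Num.sqrt (r ^+ 2 - enorm w ^+ 2).

(** [k1] on [D1] is the integrand in the variables (point of the disk, radius),
    [k2] on [D2] the same integrand in the variables (orthogonal projection to
    the equatorial hyperplane, radius): the two are related by [w = r *: u]. *)
Let D1 : set ('rV[R]_n * mR) := [set p | (enorm p.1 < 1)%R /\ (0 < p.2)%R].
Let k1 (p : 'rV[R]_n * mR) : \bar R :=
  f (p.2 *: cap_chart s p.1) * (p.2 ^+ n / cap_height p.1)%:E.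

Let D2 : set ('rV[R]_n * mR) := [set p | (enorm p.1 < p.2)%R].
Let k2 (p : 'rV[R]_n * mR) : \bar R :=
  f (rV_cons (s * leg p.2 p.1, p.1))%R * (p.2 / leg p.2 p.1)%:E.

Let measurable_inv (d : measure_display) (T : measurableType d) (h : T -> R) :
  (forall t, 0 <= h t)%R ->
  measurable_fun setT h -> measurable_fun setT (fun t => (h t)^-1)%R.
Proof.
move=> h0 mh; under eq_fun do rewrite -powR_inv1//.
by apply: (measurableT_comp (measurable_powR (-1)%R)).
Qed.

Let mD1 : measurable D1.
Proof.
have -> : D1 = @unit_disk R n `*` `]0%R, +oo[%classic.
  by apply/seteqP; split => -[u r]; rewrite /D1 /= in_itv/= andbT.
by apply: measurableX; [exact: measurable_unit_disk|exact: measurable_itv].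
Qed.

Let menorm1 : measurable_fun setT (fun p : 'rV[R]_n * mR => enorm p.1).
Proof. exact: measurableT_comp (@measurable_enorm R n) (@measurable_fst _ _ _ _). Qed.

Let mD2 : measurable D2.
Proof.
have -> : D2 = setT `&` [set p | (enorm p.1)%:E < (p.2)%:E] by rewrite setTI.
have m1 : measurable_fun setT (fun p : 'rV[R]_n * mR => (enorm p.1)%:E).
  exact/measurable_EFinP.
have m2 : measurable_fun setT (fun p : 'rV[R]_n * mR => (p.2 : R)%:E).
  by apply/measurable_EFinP; exact: measurable_snd.
exact: measurable_lte measurableT _ _ m1 m2.
Qed.

Let mk1 : measurable_fun setT k1.
Proof.
apply: emeasurable_funM.
  apply: measurableT_comp mf _.
  apply: measurable_rV_scale; first exact: measurable_snd.
  exact: measurableT_comp (measurable_cap_chart s) (@measurable_fst _ _ _ _).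
apply/measurable_EFinP; apply: measurable_funM.
  by apply: measurable_funX; exact: measurable_snd.
apply: measurable_inv; first by move=> p; exact: sqrtr_ge0.
exact: measurableT_comp (@measurable_cap_height R n) (@measurable_fst _ _ _ _).
Qed.

Let mleg : measurable_fun setT (fun p : 'rV[R]_n * mR => leg p.2 p.1).
Proof.
apply: (@measurableT_comp _ _ _ _ _ _ (@Num.sqrt R)).
  by apply: continuous_measurable_fun; exact: sqrt_continuous.
apply: measurable_funB; apply: measurable_funX => //; exact: measurable_snd.
Qed.

Let mk2 : measurable_fun setT k2.
Proof.
apply: emeasurable_funM.
  apply: measurableT_comp mf _.
  apply: (measurableT_comp (@measurable_rV_cons R n)).
  apply: measurable_fun_pair; last exact: measurable_fst.
  by apply: measurable_funM.
apply/measurable_EFinP; apply: measurable_funM; first exact: measurable_snd.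
by apply: measurable_inv => // p; exact: sqrtr_ge0.
Qed.

Let k1_ge0 p : 0 <= (k1 \_ D1) p.
Proof.
apply: erestrict_ge0 => q [_ q0]; rewrite mule_ge0// lee_fin.
by rewrite divr_ge0 ?sqrtr_ge0// exprn_ge0// ltW.
Qed.

Let k2_ge0 p : 0 <= (k2 \_ D2) p.
Proof.
apply: erestrict_ge0 => q; rewrite /D2/= => q0; rewrite mule_ge0// lee_fin.
by rewrite divr_ge0 ?sqrtr_ge0// (le_trans (enorm_ge0 q.1))// ltW.
Qed.

Let mk1D : measurable_fun setT (k1 \_ D1).
Proof. by apply/(measurable_restrictT _ mD1); exact: measurable_funTS. Qed.

Let mk2D : measurable_fun setT (k2 \_ D2).
Proof. by apply/(measurable_restrictT _ mD2); exact: measurable_funTS. Qed.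

(** At a fixed radius the substitution [w = r *: u] is a homothety of the disk;
    its factor [r ^+ n] is exactly the one that polar coordinates carry. *)
Let scale_kernel (r : R) :
  \int[N]_u (k1 \_ D1) (u, r) = \int[N]_w (k2 \_ D2) (w, r).
Proof.
have [r0|r0] := leP r 0%R.
  apply: eq_integral => u _; rewrite !patchE !memNset//.
    by rewrite /D2/= => /(le_lt_trans (enorm_ge0 u)); rewrite ltNge r0.
  by rewrite /D1/= => -[_]; rewrite ltNge r0.
have ri0 : (0 < r^-1)%R by rewrite invr_gt0.
have mk1r : measurable_fun setT (fun u => (k1 \_ D1) (u, r)).
  exact: measurableT_comp mk1D (measurable_pair2 r).
rewrite -(ge0_integral_rV_affine 0 ri0)// -ge0_integralZl//; first last.
- by rewrite lee_fin exprn_ge0// ltW.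
- apply: measurableT_comp mk1r _; apply: measurable_rV_add => //.
  exact: measurable_rV_scale.
apply: eq_integral => w _; rewrite addr0 !patchE.
have hE : (r * cap_height (r^-1 *: w) = leg r w)%R.
  rewrite /cap_height /leg -[X in (X * _)%R](ger0_norm (ltW r0)) -sqrtr_sqr.
  rewrite -sqrtrM ?sqr_ge0// enormZ (gtr0_norm ri0) exprMn mulrBr mulr1 exprVn mulrA.
  by rewrite divff ?mul1r// sqrf_eq0 gt_eqF.
have -> : ((r^-1 *: w, r) \in D1) = ((w, r) \in D2).
  apply/idP/idP; rewrite !inE /D1 /D2/= enormZ gtr0_norm// mulrC ltr_pdivrMr// mul1r.
    by case.
  by [].
case: ifPn => _; last by rewrite mule0.
rewrite /k1 /k2 /= muleCA -EFinM; congr (f _ * _%:E).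
  rewrite scale_rV_cons scalerA divff ?gt_eqF// scale1r; congr (rV_cons (_, _)).
  by rewrite mulrCA hE.
rewrite mulrA -exprMn mulVf ?gt_eqF// expr1n mul1r -hE invfM mulrA divff ?gt_eqF//.
by rewrite mul1r.
Qed.

Lemma measurable_ray_integral : measurable_fun setT (fun v : 'rV[R]_n.+1 =>
  \int[mu]_(r in `]0%R, +oo[) (f (r *: v) * (r ^+ n)%:E)).
Proof.
apply: (@measurable_section_integral R _ 'rV[R]_n.+1
  (fun p => f (p.2 *: p.1) * ((p.2 : R) ^+ n)%:E) `]0%R, +oo[%classic).
- exact: measurable_itv.
- apply: emeasurable_funM.
    apply: measurableT_comp mf _.
    by apply: measurable_rV_scale; [exact: measurable_snd|exact: measurable_fst].
  by apply/measurable_EFinP; apply: measurable_funX; exact: measurable_snd.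
- move=> v r /=; rewrite in_itv/= andbT => r0.
  by rewrite mule_ge0// lee_fin exprn_ge0// ltW.
Qed.

Lemma measurable_half_line_integral : measurable_fun setT (fun w : 'rV[R]_n =>
  \int[mu]_(t in `]0%R, +oo[) f (rV_cons (s * t, w)%R)).
Proof.
apply: (@measurable_section_integral R _ 'rV[R]_n
  (fun p => f (rV_cons (s * p.2, p.1)%R)) `]0%R, +oo[%classic).
- exact: measurable_itv.
- apply: measurableT_comp mf _.
  apply: (measurableT_comp (@measurable_rV_cons R n)).
  apply: measurable_fun_pair; last exact: measurable_fst.
  by apply: measurable_funM => //; exact: measurable_snd.
- by move=> w t _; exact: f0.
Qed.

(** Cone over one cap.  Exchanging the integrals allows to rescale the disk at
    fixed radius, and exchanging them back turns the radius into the hypotenuse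
    over the fixed leg [enorm w], to be replaced by the remaining leg [t].  Two
    substitutions in fewer variables thus replace a Jacobian in [n.+1]
    variables. *)
Lemma polar_cap :
  \int[cap_measure s]_v \int[mu]_(r in `]0%R, +oo[) (f (r *: v) * (r ^+ n)%:E) =
  \int[N]_w \int[mu]_(t in `]0%R, +oo[) f (rV_cons (s * t, w)%R).
Proof.
rewrite ge0_integral_cap; last 2 first.
- exact: measurable_ray_integral.
- move=> v; apply: integral_ge0 => r /=; rewrite in_itv/= andbT => r0.
  by rewrite mule_ge0// lee_fin exprn_ge0// ltW.
transitivity (\int[N]_u \int[mu]_r (k1 \_ D1) (u, r)).
  rewrite integral_mkcond; apply: eq_integral => u _; rewrite patchE.
  case: ifPn => uD.
    rewrite -ge0_integralZr//; first last.
    - by rewrite lee_fin invr_ge0 sqrtr_ge0.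
    - move=> r /=; rewrite in_itv/= andbT => r0.
      by rewrite mule_ge0// lee_fin exprn_ge0// ltW.
    - apply: measurable_funTS; apply: emeasurable_funM.
        by apply: measurableT_comp mf _; exact: measurable_rV_scale.
      by apply/measurable_EFinP; exact: measurable_funX.
    rewrite integral_mkcond; apply: eq_integral => r _; rewrite !patchE.
    rewrite (_ : (r \in _) = ((u, r) \in D1)); last first.
      apply/idP/idP; rewrite !inE /D1 /= in_itv/= andbT; last by case.
      by move=> ->; split => //; move: uD; rewrite inE.
    by case: ifPn => // _; rewrite -muleA -EFinM.
  rewrite integral0_eq// => r _; rewrite patchE memNset//.
  by rewrite /D1/= => -[ud _]; move: uD; rewrite notin_setE; exact.
rewrite (@fubini_tonelli _ _ 'rV[R]_n mR R N mu (k1 \_ D1)) => //.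
under eq_integral do rewrite scale_kernel.
rewrite -(@fubini_tonelli _ _ 'rV[R]_n mR R N mu (k2 \_ D2)) => //.
apply: eq_integral => w _.
rewrite (@ge0_integral_subst_leg _ (enorm w))//; last 2 first.
- exact: enorm_ge0.
- apply: measurableT_comp mf _; apply: measurableT_comp (@measurable_rV_cons R n) _.
  by apply: measurable_fun_pair => //; exact: measurable_funM.
rewrite [RHS]integral_mkcond; apply: eq_integral => r _; rewrite !patchE.
rewrite (_ : (r \in _) = ((w, r) \in D2))//.
by apply/idP/idP; rewrite !inE /D2 /= in_itv/= andbT.
Qed.

End polar_cap.

Section polar.
Context {R : realType}.
Local Notation mu := (@lebesgue_measure R).
Local Open Scope ereal_scope.

(** The two caps cover the two half-spaces of positive and of negative first
    coordinate. *)
Lemma polar_coordinates n (f : 'rV[R]_n.+1 -> \bar R) :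
  measurable_fun setT f -> (forall y, 0 <= f y) ->
  \int[sphere_measure n.+1]_v
    \int[mu]_(r in `]0%R, +oo[) (f (r *: v) * (r ^+ n)%:E) =
  \int[lebesgue_rV n.+1]_y f y.
Proof.
move=> mf f0; rewrite ge0_integral_measure_add//; first last.
- exact: measurable_ray_integral.
- move=> v _; apply: integral_ge0 => r /=; rewrite in_itv/= andbT => r0.
  by rewrite mule_ge0// lee_fin exprn_ge0// ltW.
rewrite !polar_cap// ge0_integral_rV_cons//.
rewrite -ge0_integralD//; first last.
- exact: measurable_half_line_integral.
- by move=> w _; exact: integral_ge0.
- exact: measurable_half_line_integral.
- by move=> w _; exact: integral_ge0.
apply: eq_integral => w _; rewrite [RHS]ge0_integral_split0//; last first.
  apply: measurableT_comp mf _; apply: measurableT_comp (@measurable_rV_cons R n) _.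
  exact: measurable_pair2.
by congr (_ + _); apply: eq_integral => t _; rewrite ?mul1r ?mulN1r.
Qed.

End polar.

(** * The area of the sphere *)

Section area.
Context {R : realType}.
Local Notation mu := (@lebesgue_measure R).
Local Open Scope ereal_scope.

Lemma measurable_esphere n : measurable (@esphere R n).
Proof.
have -> : @esphere R n = setT `&` @enorm R n @^-1` [set 1%R] by rewrite setTI.
by apply: measurable_enorm.
Qed.

Lemma cap_chart_esphere n (s : R) (u : 'rV[R]_n) :
  (s ^+ 2 = 1)%R -> unit_disk u -> esphere n.+1 (cap_chart s u).
Proof.
move=> s2 ud; apply/eqP; rewrite -(@eqrXn2 _ 2) ?enorm_ge0// expr1n.
rewrite sqr_enorm_cons exprMn s2 mul1r /cap_height sqr_sqrtr ?subrK//.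
by rewrite subr_ge0 exprn_ile1// ?enorm_ge0// ltW.
Qed.

Lemma ge0_integral_esphere n (g : 'rV[R]_n.+1 -> \bar R) :
  measurable_fun setT g -> (forall v, 0 <= g v) ->
  \int[sphere_measure n.+1]_(v in esphere n.+1) g v =
  \int[sphere_measure n.+1]_v g v.
Proof.
move=> mg g0; have mS := @measurable_esphere n.+1.
have gS0 v : 0 <= (g \_ (esphere n.+1)) v by exact: erestrict_ge0.
have mgS : measurable_fun setT (g \_ (esphere n.+1)).
  by apply/(measurable_restrictT _ mS); exact: measurable_funTS.
rewrite integral_mkcond !ge0_integral_measure_add// !ge0_integral_cap//.
congr (_ + _); apply: eq_integral => u; rewrite inE => ud; rewrite patchE mem_set//.
  by apply: cap_chart_esphere => //; rewrite expr1n.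
by apply: cap_chart_esphere => //; rewrite sqrrN expr1n.
Qed.

Lemma measurable_rV_gauss n :
  measurable_fun setT (fun y : 'rV[R]_n => (expR (- enorm y ^+ 2))%:E).
Proof.
apply/measurable_EFinP; apply: measurableT_comp => //.
apply: measurableT_comp => //; apply: measurable_funX; exact: measurable_enorm.
Qed.

Lemma integral_rV_gauss n :
  \int[lebesgue_rV n]_y (expR (- enorm (y : 'rV[R]_n) ^+ 2))%:E =
  (Num.sqrt pi ^+ n)%:E.
Proof.
elim: n => [|n IHn].
  rewrite /= integral_dirac; [|by []|exact: (@measurable_rV_gauss 0)].
  rewrite diracT mul1e expr0 sqr_enorm big_ord0 oppr0.
  by rewrite expR0.
rewrite ge0_integral_rV_cons; [|exact: measurable_rV_gauss|
  by move=> y; rewrite lee_fin expR_ge0].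
transitivity (\int[lebesgue_rV n]_w
    ((Num.sqrt pi)%:E * (expR (- enorm (w : 'rV[R]_n) ^+ 2))%:E)).
  apply: eq_integral => w _.
  under eq_integral do rewrite sqr_enorm_cons opprD expRD EFinM.
  rewrite ge0_integralZr//; last first.
    by apply/measurable_EFinP; exact: (@gauss_integral.measurable_gauss_fun R).
  by congr (_ * _); exact: integralT_gauss.
rewrite ge0_integralZl ?lee_fin ?sqrtr_ge0//.
  by rewrite IHn exprS EFinM.
exact: measurable_rV_gauss.
Qed.

(** The radial part of the Gaussian integral in dimension [n.+1]. *)
Let gauss_moment n : \bar R :=
  \int[mu]_(r in `]0%R, +oo[) (expR (- r ^+ 2) * r ^+ n)%:E.

(** Substitute [t = r ^+ 2]. *)
Let Gamma_moment n :
  \int[mu]_(t in `]0%R, +oo[) (t `^ (n.+1%:R / 2 - 1) * expR (- t))%:E =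
  2%:E * gauss_moment n.
Proof.
transitivity (\int[mu]_(r in `]0%R, +oo[)
    ((((r ^+ 2) `^ (n.+1%:R / 2 - 1) * expR (- r ^+ 2))%:E * (2 * r)%:E))).
  apply: (@ge0_integral_subst_increasing _ (fun r => r ^+ 2)%R (fun r => 2 * r)%R Num.sqrt 0
    (fun t => (t `^ (n.+1%:R / 2 - 1) * expR (- t))%:E)).
  - by apply: cvg_at_right_filter; exact: exprn_continuous.
  - move=> r _.
    have := is_deriveX 2 (is_derive_id r (1%R : R)).
    by rewrite expr1 [X in is_derive _ _ _ X]mulr1.
  - by move=> r _; apply: cvgM; [exact: cvg_cst|exact: cvg_id].
  - by move=> r r0; rewrite mulr_ge0// ltW.
  - exact: exprn_measurable.
  - exact: sqrtr0.
  - by move=> t _; exact: sqrtr_ge0.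
  - by move=> t t0; exact: sqr_sqrtr.
  - move=> r t r0 t0; rewrite -[in RHS](ger0_norm (ltW r0)) -sqrtr_sqr.
    by rewrite ler_sqrt.
  - apply/measurable_EFinP; apply: measurable_funM; first exact: measurable_powR.
    by apply: measurableT_comp => //; exact: measurableT_comp.
  - by move=> t; rewrite lee_fin mulr_ge0 ?powR_ge0 ?expR_ge0.
rewrite -ge0_integralZl//; last 2 first.
- apply/measurable_EFinP; apply: measurable_funTS; apply: measurable_funM => //.
  by apply: measurableT_comp => //; apply: measurableT_comp.
- move=> r /=; rewrite in_itv/= andbT => r0.
  by rewrite lee_fin mulr_ge0 ?expR_ge0// exprn_ge0// ltW.
apply: eq_integral => r; rewrite inE/= in_itv/= andbT => r0.
rewrite -!EFinM; congr EFin.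
suff <- : ((r ^+ 2) `^ (n.+1%:R / 2 - 1) * r = r ^+ n)%R by ring.
rewrite -powR_mulrn ?ltW// -powRrM -[X in (_ * X)%R]powRr1 ?ltW//.
rewrite -powRD; last by rewrite (gt_eqF r0) implybT.
rewrite -powR_mulrn ?ltW//; congr (_ `^ _)%R.
by rewrite -natr1; field.
Qed.

(** The Gaussian integral is [sqrt pi ^+ n.+1] by Tonelli, and the
    product of its radial part by the area of the sphere by polar coordinates.
    Neither factor is known to be finite beforehand: a product that is finite
    and positive forces both to be so. *)
Lemma sphere_measure_esphere n :
  sphere_measure n.+1 (esphere n.+1) = (@sphere_area R n.+1)%:E.
Proof.
have sqrt_pi_gt0 : (0 < Num.sqrt (@pi R))%R by rewrite sqrtr_gt0 pi_gt0.
pose g (y : 'rV[R]_n.+1) : \bar R := (expR (- enorm y ^+ 2))%:E.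
have g0 y : 0 <= g y by rewrite lee_fin expR_ge0.
have mg : measurable_fun setT g by exact: measurable_rV_gauss.
have polar : gauss_moment n * sphere_measure n.+1 (@esphere R n.+1) =
    (Num.sqrt pi ^+ n.+1)%:E.
  rewrite -integral_rV_gauss -(polar_coordinates mg g0) -ge0_integral_esphere//.
  - rewrite -integral_cst; last exact: measurable_esphere.
    apply: eq_integral => v; rewrite inE => vS; apply: eq_integral => r _.
    by rewrite /g enormZ vS mulr1 real_normK ?num_real// EFinM.
  - exact: measurable_ray_integral.
  - move=> v; apply: integral_ge0 => r /=; rewrite in_itv/= andbT => r0.
    by rewrite mule_ge0// lee_fin exprn_ge0// ltW.
have piE : (Num.sqrt (@pi R) ^+ n.+1 = pi `^ (n.+1%:R / 2))%R.
  by rewrite -powR12_sqrt ?pi_ge0// -powR_mulrn ?powR_ge0// -powRrM mulrC.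
have S0 : 0 <= sphere_measure n.+1 (@esphere R n.+1) by exact: measure_ge0.
have P0 : (0 < Num.sqrt (@pi R) ^+ n.+1)%R by rewrite exprn_gt0.
have M0 : 0 <= gauss_moment n.
  apply: integral_ge0 => r /=; rewrite in_itv/= andbT => r0.
  by rewrite lee_fin mulr_ge0 ?expR_ge0// exprn_ge0// ltW.
have := Gamma_moment n; rewrite /Gamma /sphere_area /Gamma /Rintegral => ->.
rewrite -piE; move: (gauss_moment n) (sphere_measure _ _) polar M0 S0.
case=> [c| |//] [x| |//] /= polar c0 x0.
- case: polar => cx; have c1 : (c != 0)%R.
    by apply/eqP => c1; move: P0; rewrite -cx c1 mul0r ltxx.
  by congr EFin; rewrite -cx; field.
- move: c0 polar; rewrite le_eqVlt => /predU1P[[<-]|c0].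
    by rewrite mul0e => -[P1]; rewrite -P1 ltxx in P0.
  by rewrite gt0_muley.
- move: x0 polar; rewrite le_eqVlt => /predU1P[[<-]|x0].
    by rewrite mule0 => -[P1]; rewrite -P1 ltxx in P0.
  by rewrite gt0_mulye.
- by move: polar; rewrite mulyy.
Qed.

End area.

(** * The radial function *)

Section enorm_sup.
Context {R : realType} {n : nat}.
Implicit Types (u : 'rV[R]_n) (K : R).

Lemma coord_le_enorm u i : `|u ord0 i| <= enorm u.
Proof.
rewrite -sqrtr_sqr ler_wsqrtr// (bigD1 i)//= lerDl.
by apply: sumr_ge0 => j _; exact: sqr_ge0.
Qed.

Lemma enorm_le_coord u K : (forall i, `|u ord0 i| <= K) ->
  enorm u <= Num.sqrt (\sum_(i < n) K ^+ 2).
Proof.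
move=> uK; rewrite ler_wsqrtr// ler_sum// => i _.
rewrite -[leLHS]real_normK ?num_real// lerXn2r ?nnegrE//.
exact: le_trans (uK i).
Qed.

Lemma coord_le_norm u i : `|u ord0 i| <= `|u|.
Proof.
by rewrite [leRHS]/Num.norm /= mx_normrE; apply/bigmax_geP; right; exists (ord0, i).
Qed.

End enorm_sup.

Section star_body.
Context {R : realType} {n : nat}.
Variables (Omega : set 'rV[R]_n) (x : 'rV[R]_n).
Hypotheses (cO : compact Omega) (Ox : Omega° x) (starO : star_shaped Omega x).

Let rho := radial [set y - x | y in Omega].

Let closedO : closed Omega.
Proof. by apply: compact_closed => //; exact: norm_hausdorff. Qed.

Let radialE v : rho v = sup [set a | 0 <= a /\ Omega (x + a *: v)].
Proof.
congr sup; apply/seteqP; split => a /= -[a0].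
  by move=> [y Oy yx]; split => //; rewrite -yx addrC subrK.
by move=> Oa; split => //; exists (x + a *: v) => //; rewrite addrAC subrr add0r.
Qed.

Lemma interior_enorm_ball : exists2 e, 0 < e & forall y, enorm (y - x) < e -> Omega y.
Proof.
have /nbhs_ballP[e /= e0 xeO] := Ox; exists e => // y yxe.
apply: xeO; split => // i j; rewrite (ord1 i) /ball /= distrC.
by have := coord_le_enorm (y - x) j; rewrite !mxE => /le_lt_trans; exact.
Qed.

Lemma compact_enorm_bounded : exists C, forall y, Omega y -> enorm (y - x) <= C.
Proof.
have [M [_ /(_ (M + 1))]] := compact_bounded cO.
rewrite ltrDl => /(_ ltr01) OM.
exists (Num.sqrt (\sum_(i < n) (M + 1 + `|x|) ^+ 2)) => y Oy.
apply: enorm_le_coord => i; rewrite !mxE (le_trans (ler_normB _ _))// lerD//.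
  exact: le_trans (coord_le_norm _ _) (OM _ Oy).
exact: coord_le_norm.
Qed.

(** Points of the ray strictly below the supremum belong to [Omega] because it is
    star-shaped, and the supremum itself does because [Omega] is closed. *)
Lemma radialP v r : enorm v = 1 -> 0 <= r ->
  Omega (x + r *: v) <-> r <= rho v.
Proof.
move=> v1 r0; rewrite radialE; set E := [set a | _].
have E0 : E 0 by split => //; rewrite scale0r addr0; exact: interior_subset Ox.
have Esup : has_sup E.
  split; first by exists 0.
  have [C OC] := compact_enorm_bounded; exists C => a [a0 /OC].
  by rewrite addrAC subrr add0r enormZ v1 mulr1 ger0_norm.
split=> [Or|]; first by apply: sup_upper_bound.
have inE s : 0 <= s -> s < sup E -> Omega (x + s *: v).
  move=> s0 /(sup_gt (ex_intro _ _ E0))[a [a0 Oa] sa].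
  have a_gt0 : 0 < a := le_lt_trans s0 sa.
  have v0 : v != 0.
    apply/eqP => v0; move/eqP : v1; rewrite v0 -[X in enorm X](scale0r 0) enormZ.
    by rewrite normr0 mul0r eq_sym oner_eq0.
  have := starO (p := x + a *: v) _ (t := s / a) _.
  rewrite scalerDr scalerA divfK ?gt_eqF// addrA -scalerDl subrK scale1r.
  apply.
    split => // /eqP; rewrite -subr_eq0 addrAC subrr add0r scaler_eq0.
    by rewrite (negbTE v0) (gt_eqF a_gt0).
  by rewrite divr_ge0//= ler_pdivrMr// mul1r ltW.
rewrite le_eqVlt => /predU1P[rE|]; last exact: inE.
have [->|r_gt0] := eqVneq r 0; first exact: E0.2.
have {}r_gt0 : 0 < r by rewrite lt_neqAle eq_sym r_gt0.
have cvgr : (x + s *: v) @[s --> r^'-] --> x + r *: v.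
  apply: cvgD; first exact: cvg_cst.
  apply: cvgZr_tmp.
  apply: cvg_at_left_filter.
  exact: cvg_id.
have := @closed_cvg R 'rV[R]_n r^'- _ (fun s => x + s *: v) Omega
  closedO _ _ cvgr; apply.
  near=> s; apply: inE; first by near: s; exact: nbhs_left_ge.
  by rewrite -rE; near: s; exact: nbhs_left_lt.
Unshelve. all: by end_near. Qed.

Lemma radial_gt0 : exists2 e, 0 < e & forall v, enorm v = 1 -> e <= rho v.
Proof.
have [e e0 eO] := interior_enorm_ball; exists (e / 2); first by rewrite divr_gt0.
move=> v v1; apply/radialP => //; first by rewrite ltW// divr_gt0.
apply: eO; rewrite addrAC subrr add0r enormZ v1 mulr1 gtr0_norm ?divr_gt0//.
by rewrite ltr_pdivrMr// ltr_pMr// ltr1n.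
Qed.

Lemma radial_bounded : exists C, forall v, enorm v = 1 -> rho v <= C.
Proof.
have [C OC] := compact_enorm_bounded; exists C => v v1.
have [e e0 eO] := radial_gt0.
have r0 : 0 <= rho v by rewrite (le_trans (ltW e0))// eO.
have /OC : Omega (x + rho v *: v) by apply/radialP.
by rewrite addrAC subrr add0r enormZ v1 mulr1 ger0_norm.
Qed.

(** The superlevel set of level [r >= 0] is the preimage of the closed set
    [Omega] under [v |-> x + r *: v]. *)
Lemma measurable_radial : measurable_fun (@esphere R n) rho.
Proof.
have mS := @measurable_esphere R n.
apply: (measurability (@RGenCInfty.G R)) => [|/= _ [_] [r] -> <-].
  exact: RGenCInfty.measurableE.
have [r0|r0] := leP 0 r; last first.
  rewrite (_ : _ `&` _ = esphere n)//; apply/seteqP; split => v; first by case.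
  move=> v1; split => //=; rewrite in_itv/= andbT.
  have [e e0 eO] := radial_gt0; rewrite (le_trans (ltW r0))//.
  by rewrite (le_trans (ltW e0))// eO.
rewrite (_ : _ `&` _ = esphere n `&` (fun v => x + r *: v) @^-1` Omega).
  apply: measurableI => //; rewrite -[X in measurable X]setTI.
  have : measurable_fun setT (fun v : 'rV[R]_n => x + r *: v).
    by apply: measurable_rV_add => //; exact: measurable_rV_scale.
  by apply => //; exact: closed_measurable_rV.
apply/seteqP; split => v [v1] /=; rewrite in_itv/= andbT => h; split => //.
  exact/radialP.
exact/radialP.
Qed.

End star_body.

(** * The potential in polar coordinates *)

Section power_primitive.
Context {R : realType}.
Local Notation mu := (@lebesgue_measure R).
Implicit Types (a b r alpha : R).

(** A primitive of [r `^ (alpha - 1)] on the positive reals.  It gives one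
    statement for the two formulas of the theorem, and makes the cases
    [alpha != 0] and [alpha = 0] of the renormalization the same computation. *)
Definition pow_prim alpha r : R :=
  if alpha == 0 then ln r else r `^ alpha / alpha.

Lemma measurable_pow_prim alpha : measurable_fun setT (pow_prim alpha).
Proof.
have [->|al0] := eqVneq alpha 0.
  by rewrite (_ : pow_prim 0 = @ln R)//; apply/funext => r; rewrite /pow_prim eqxx.
rewrite (_ : pow_prim alpha = fun r => r `^ alpha / alpha).
  by apply: measurable_funM => //; exact: measurable_powR.
by apply/funext => r; rewrite /pow_prim (negbTE al0).
Qed.

Lemma integral_powR alpha a b : 0 <= a -> a <= b -> 0 < a \/ 0 < alpha ->
  (\int[mu]_(r in `]a, b]) (r `^ (alpha - 1))%:E =
   (pow_prim alpha b - pow_prim alpha a)%:E)%E.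
Proof.
move=> a0 ab aalpha.
have dprim r : 0 < r -> is_derive r 1 (pow_prim alpha) (r `^ (alpha - 1)).
  move=> r0; rewrite /pow_prim; have [->|al0] := eqVneq alpha 0.
    by rewrite sub0r powR_inv1 ?ltW//; exact: is_derive1_ln.
  have dp := is_derive1_powR alpha r0.
  have dc := is_derive_cst alpha^-1 r (1 : R).
  have := is_deriveM dp dc.
  by rewrite scaler0 add0r [_ *: _]mulrA mulVf// mul1r.
apply: ge0_FTC_itvoc => //.
- have [a1|] := ltP 0 a.
    apply: cvg_at_right_filter; apply: differentiable_continuous.
    by apply/derivable1_diffP; case: (dprim _ a1).
  move=> a1; have a_eq0 : a = 0 by apply/eqP; rewrite eq_le a1.
  case: aalpha => [|al0]; first by rewrite ltNge a1.
  rewrite a_eq0 /pow_prim gt_eqF//.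
  rewrite powR0 ?gt_eqF// mul0r -[X in _ --> X](mul0r alpha^-1).
  by apply: cvgM; [exact: powR_cvg0|exact: cvg_cst].
- by move=> r ar; apply: dprim; exact: le_lt_trans ar.
- move=> r ar; apply: differentiable_continuous; apply/derivable1_diffP.
  by case: (is_derive1_powR (alpha - 1) (le_lt_trans a0 ar)).
- by move=> r _; exact: powR_ge0.
Qed.

(** The difference is the integral of a positive function. *)
Lemma pow_prim_le alpha a b : 0 < a -> a <= b ->
  pow_prim alpha a <= pow_prim alpha b.
Proof.
move=> a0 ab; rewrite -subr_ge0 -lee_fin -integral_powR ?(ltW a0)//; last by left.
by apply: integral_ge0 => r _; rewrite lee_fin powR_ge0.
Qed.

End power_primitive.

Section potential_of_star_body.
Context {R : realType} {n : nat}.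
Variables (Omega : set 'rV[R]_n.+1) (x : 'rV[R]_n.+1).
Hypotheses (cO : compact Omega) (Ox : Omega° x) (starO : star_shaped Omega x).
Local Notation mu := (@lebesgue_measure R).
Local Notation rho := (radial [set y - x | y in Omega]).
Local Notation S := (esphere n.+1).
Local Open Scope ereal_scope.

Let closedO : closed Omega.
Proof. by apply: compact_closed => //; exact: norm_hausdorff. Qed.

Let measurable_shell e : measurable (Omega `\` eball x e).
Proof.
apply: measurableD; first exact: closed_measurable_rV.
have -> : eball x e = (fun y => enorm (y - x)) @^-1` `]-oo, e[.
  by apply/seteqP; split => y; rewrite /eball /= in_itv.
rewrite -[X in measurable X]setTI.
have : measurable_fun setT (fun y : 'rV[R]_n.+1 => enorm (y - x)).
  apply: measurableT_comp; first exact: measurable_enorm.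
  exact: measurable_rV_add.
by apply => //; exact: measurable_itv.
Qed.

(** In direction [v] the set [Omega] without the ball is the interval from [e] to
    [rho v], on which polar coordinates integrate [r `^ (alpha - m) * r ^+ (m - 1)].
    With [e = 0] the ball is empty, which covers [alpha > 0] directly. *)
Lemma riesz_integral_shell alpha e : (0 <= e)%R -> (0 < e)%R \/ (0 < alpha)%R ->
  (forall v, S v -> (e <= rho v)%R) ->
  riesz_integral alpha (Omega `\` eball x e) x =
  \int[sphere_measure n.+1]_(v in S) (pow_prim alpha (rho v) - pow_prim alpha e)%:E.
Proof.
move=> e0 ealpha erho; set A := Omega `\` eball x e.
have mA : measurable A by exact: measurable_shell.
pose g (y : 'rV[R]_n.+1) : \bar R := (enorm (x - y) `^ (alpha - n.+1%:R))%:E.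
have mg : measurable_fun setT g.
  apply/measurable_EFinP; apply: (measurableT_comp (measurable_powR _)).
  apply: measurableT_comp; first exact: measurable_enorm.
  apply: measurable_rV_add => //.
  have : measurable_fun setT (fun y : 'rV[R]_n.+1 => -1 *: y)%R.
    exact: measurable_rV_scale.
  by under eq_fun do rewrite scaleN1r.
have gA0 y : 0 <= (g \_ A) y.
  by apply: erestrict_ge0 => z _; rewrite lee_fin powR_ge0.
have mgA : measurable_fun setT (g \_ A).
  by apply/(measurable_restrictT _ mA); exact: measurable_funTS.
have mf : measurable_fun setT (fun y : 'rV[R]_n.+1 => (g \_ A) (1 *: y + x)%R).
  apply: measurableT_comp mgA _; apply: measurable_rV_add => //.
  exact: measurable_rV_scale.
rewrite /riesz_integral integral_mkcond -/g.
rewrite -(@ge0_integral_rV_affine R n.+1 1 x (g \_ A) ltr01 mgA gA0).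
rewrite expr1n mul1e.
rewrite -(polar_coordinates mf (fun y => gA0 _)) -ge0_integral_esphere; first last.
- move=> v; apply: integral_ge0 => r /=; rewrite in_itv/= andbT => r0.
  by rewrite mule_ge0// lee_fin exprn_ge0// ltW.
- exact: (measurable_ray_integral mf (fun y => gA0 _)).
apply: eq_integral => v; rewrite inE => vS.
rewrite -integral_powR//; last exact: erho.
have ray (I : set R) :
    (forall r, I r <-> [/\ (0 < r)%R, (e <= r)%R & (r <= rho v)%R]) ->
  \int[mu]_(r in `]0%R, +oo[) ((g \_ A) (1 *: (r *: v) + x)%R * (r ^+ n)%:E) =
  \int[mu]_(r in I) (r `^ (alpha - 1))%:E.
  move=> IE; rewrite integral_mkcond [RHS]integral_mkcond.
  apply: eq_integral => r _; rewrite !patchE scale1r (addrC _ x).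
  have [r0|r0] := ltP 0%R r; last first.
    rewrite !memNset//; first by move=> /IE[]; rewrite ltNge r0.
    by rewrite /= in_itv/= andbT ltNge r0.
  rewrite mem_set/=; last by rewrite in_itv/= andbT.
  have vr : enorm (r *: v) = r by rewrite enormZ vS mulr1 gtr0_norm.
  have AE : A (x + r *: v)%R <-> I r.
    rewrite IE /A /= /eball/= (addrC x) addrK vr; split.
      move=> [+ /negP]; rewrite -leNgt (addrC _ x) => Or er.
      by split => //; apply/radialP => //; exact: ltW.
    move=> [_ er rr]; split; last by apply/negP; rewrite -leNgt.
    by rewrite (addrC _ x); apply/radialP => //; exact: ltW.
  rewrite (_ : (_ \in A) = (r \in I)); last first.
    by apply/idP/idP => /set_mem/AE/mem_set.
  case: ifPn => _; last by rewrite mul0e.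
  rewrite /g opprD addrA subrr add0r -scaleN1r enormZ normrN1 mul1r vr -EFinM.
  congr EFin; rewrite -powR_mulrn ?ltW// -powRD; last by rewrite (gt_eqF r0) implybT.
  by congr (_ `^ _)%R; rewrite -natr1; ring.
(* The set of radii is [e, rho v], except for [e = 0], where polar coordinates
   exclude the origin. *)
have [e1|e1] := ltP 0%R e.
  rewrite integral_itv_obnd_cbnd.
    apply: ray => r /=; rewrite in_itv/=; split.
      by move=> /andP[er ->]; rewrite er (lt_le_trans e1).
    by move=> [_ -> ->].
  apply/measurable_EFinP; apply: measurable_funTS; exact: measurable_powR.
have -> : e = 0%R by apply/eqP; rewrite eq_le e1.
apply: ray => r /=; rewrite in_itv/=; split.
  by move=> /andP[r0 ->]; rewrite r0 (le_trans e1) ?ltW.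
by move=> [-> _ ->].
Qed.

Local Notation sigma := (@sphere_measure R n.+1).

Let integrable_prim alpha :
  sigma.-integrable S (fun v => (pow_prim alpha (rho v))%:E).
Proof.
have [e e0 erho] := radial_gt0 cO Ox starO.
have [C rhoC] := radial_bounded cO Ox starO.
apply: measurable_bounded_integrable.
- exact: measurable_esphere.
- by rewrite [X in X < _]sphere_measure_esphere ltry.
- apply: measurableT_comp; first exact: measurable_pow_prim.
  exact: measurable_radial.
- exists (`|pow_prim alpha e| + `|pow_prim alpha C|)%R; split; first exact: num_real.
  move=> M KM v Sv /=; apply: le_trans (ltW KM).
  have ep := pow_prim_le alpha e0 (erho _ Sv).
  have pC := pow_prim_le alpha (lt_le_trans e0 (erho _ Sv)) (rhoC _ Sv).
  have eN := ler_norm (- pow_prim alpha e); have CN := ler_norm (pow_prim alpha C).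
  have e_ge0 := normr_ge0 (pow_prim alpha e).
  have C_ge0 := normr_ge0 (pow_prim alpha C).
  by rewrite normrN in eN; rewrite ler_norml; apply/andP; split; lra.
Qed.

(** The term subtracted in the renormalization is the primitive at [eps] times
    the area of the sphere up to sign, which is the contribution of the inner
    boundary of the shell.  Hence there is no limit to take: the renormalized
    integral is constant as soon as the ball fits in [Omega]. *)
Lemma renormalized_integral_near alpha :
  \forall eps \near 0%R^'+, renormalized_integral alpha Omega x eps =
    \int[sigma]_(v in S) (pow_prim alpha (rho v))%:E.
Proof.
have [e e0 erho] := radial_gt0 cO Ox starO.
near=> eps.
have eps0 : (0 < eps)%R by near: eps; exact: nbhs_right_gt.
have eps_rho v : S v -> (eps <= rho v)%R.
  move=> Sv; apply: le_trans (erho _ Sv).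
  by near: eps; exact: nbhs_right_le.
rewrite /renormalized_integral.
rewrite (riesz_integral_shell (ltW eps0) (or_introl eps0) eps_rho).
have mS := @measurable_esphere R n.+1.
have intc : sigma.-integrable S (fun=> (pow_prim alpha eps)%:E).
  apply: measurable_bounded_integrable => //.
    by rewrite [X in X < _]sphere_measure_esphere ltry.
  exists `|pow_prim alpha eps|%R; split; first exact: num_real.
  by move=> M KM v _; exact: ltW.
have cstE : \int[sigma]_(v in S) (pow_prim alpha eps)%:E =
    (pow_prim alpha eps * sphere_area n.+1)%:E.
  by rewrite (integral_cst sigma mS) [X in _ * X]sphere_measure_esphere -EFinM.
rewrite integralB_EFin//; last exact: integrable_prim.
rewrite [X in _ - X - _]cstE.
have /fineK <- : \int[sigma]_(v in S) (pow_prim alpha (rho v))%:E \is a fin_num.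
  exact: integrable_fin_num.
rewrite -!EFinB; congr EFin; move: (fine _) => i; rewrite /pow_prim.
have [_|al0] := eqVneq alpha 0%R; first by rewrite lnV//; ring.
have ea0 : (eps `^ alpha != 0)%R by rewrite gt_eqF// powR_gt0.
by rewrite powRN; field; rewrite ea0.
Unshelve. all: by end_near. Qed.

Lemma renormalized_integral_cvg alpha :
  renormalized_integral alpha Omega x eps @[eps --> 0%R^'+] -->
  \int[sigma]_(v in S) (pow_prim alpha (rho v))%:E.
Proof. by apply: cvg_near_cst; exact: renormalized_integral_near. Qed.

Lemma integral_pow_prim alpha : alpha != 0%R ->
  \int[sigma]_(v in S) (pow_prim alpha (rho v))%:E =
  (alpha^-1)%:E * \int[sigma]_(v in S) (rho v `^ alpha)%:E.
Proof.
move=> al0.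
have pE v : (rho v `^ alpha)%:E = alpha%:E * (pow_prim alpha (rho v))%:E.
  by rewrite /pow_prim (negbTE al0) -EFinM mulrCA divff// mulr1.
under [in RHS]eq_integral do rewrite pE.
rewrite integralZl//; last exact: measurable_esphere.
by rewrite muleA -EFinM mulVf// mul1e.
Qed.

Lemma potential_star_body alpha :
  potential alpha Omega x =
  \int[sigma]_(v in S) (pow_prim alpha (rho v))%:E.
Proof.
rewrite /potential; case: asboolP => [[al0 _]|al0].
  by apply/cvg_lim => //; exact: renormalized_integral_cvg.
have {}al0 : (0 < alpha)%R.
  by rewrite ltNge; apply/negP => al1; exact: al0.
have [e e0 erho] := radial_gt0 cO Ox starO.
have eball0 : eball x 0 = set0.
  apply/seteqP; split => y //; rewrite /eball /= => /(le_lt_trans (enorm_ge0 _)).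
  by rewrite ltxx.
transitivity (riesz_integral alpha (Omega `\` eball x 0) x).
  by rewrite eball0 setD0.
rewrite riesz_integral_shell//; last 2 first.
- by right.
- by move=> v Sv; rewrite (le_trans (ltW e0))// erho.
rewrite /pow_prim gt_eqF// powR0 ?gt_eqF// mul0r.
by under eq_integral do rewrite subr0.
Qed.

End potential_of_star_body.

Theorem lemma2p19 (R : realType) (m : nat) (hm : (2 <= m)%N)
    (Omega : set 'rV[R]_m) (hbody : body Omega)
    (hC1 : piecewise_C1_boundary Omega)
    (x : 'rV[R]_m) (hx : Omega° x) (hstar : star_shaped Omega x) :
  let rho := radial [set y - x | y in Omega] in
  (forall alpha : R, alpha <= 0 ->
     cvg (renormalized_integral alpha Omega x eps @[eps --> 0^'+])) /\
  (forall alpha : R, alpha != 0 ->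
     potential alpha Omega x =
     ((alpha^-1)%:E *
       \int[sphere_measure m]_(v in esphere m) (rho v `^ alpha)%:E)%E) /\
  potential 0 Omega x =
    (\int[sphere_measure m]_(v in esphere m) (ln (rho v))%:E)%E.
Proof.
move=> rho; case: hbody => cO _ {hC1}.
case: m hm Omega cO x hx hstar @rho => [//|n] _ Omega cO x Ox starO rho.
split=> [alpha _|].
  by apply/cvg_ex; eexists; exact: renormalized_integral_cvg.
split=> [alpha al0|]; rewrite potential_star_body//; first exact: integral_pow_prim.
by apply: eq_integral => v _; rewrite /pow_prim eqxx.
Qed.
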